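(* (In $\mathbf{ZF}$.) (i) For every second-countable metrizable space $\mathbf{X}$: (a) every subspace of $\mathbf{X}$ is a $k$-space if and only if $\mathbf{X}$ is Fréchet-Urysohn; (b) if every subspace of $\mathbf{X}$ is a $k$-space, then every uncountable subset of $X$ contains an infinite closed subset of $\mathbf{X}$. (ii) The following three statements are equivalent: $\mathbf{CAC}(\mathbb{R})$; ''for every second-countable metrizable space $\mathbf{X}$, every subspace of $\mathbf{X}$ is a $k$-space''; ''every second-countable metrizable space is a $k$-space''. (iii) If every second-countable metrizable space is a $k$-space, then for every second-countable metrizable space $\mathbf{X}$, every uncountable subset of $X$ contains an infinite closed subset of $\mathbf{X}$.
   Context: The result is a theorem of $\mathbf{ZF}$ (Zermelo–Fraenkel set theory without the axiom of choice). A set is countable if it is equipotent with a subset of $\omega$, uncountable otherwise, and denumerable if it is countable and infinite. $\mathbf{CAC}(\mathbb{R})$: every denumerable family of non-empty subsets of $\mathbb{R}$ has a choice function. A space $\mathbf{X}$ is a $k$-space if it is Hausdorff and every set $A\subseteq X$, such that $A\cap K$ is closed in $\mathbf{X}$ for every compact $K\subseteq X$, is closed in $\mathbf{X}$. A space $\mathbf{X}$ is Fréchet-Urysohn if, for every $A\subseteq X$ and every $x$ in the closure of $A$, there is a sequence of points of $A$ converging in $\mathbf{X}$ to $x$. *)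

(* Defs.v *)
(* The base theory is first-order ZF.  The type theory proves choice principles
   once choice axioms are assumed, so sets are not rendered as types here: they
   are elements of an arbitrary model [M] of ZF, with Separation and Replacement
   available for first-order formulas with parameters only.  Every notion from
   set theory or topology below quantifies over elements of [M] alone, hence is
   expressed by a first-order formula in the membership relation; truth in all
   models is, by soundness and completeness, provability in ZF. *)

Set Implicit Arguments.

Record set_structure : Type := SetStructure {
  carrier :> Type;
  mem : carrier -> carrier -> Prop
}.
Arguments mem {s} _ _.

Declare Scope zf_scope.
Delimit Scope zf_scope with zf.
Open Scope zf_scope.

Notation "x ∈ y" := (mem x y) (at level 70, no associativity) : zf_scope.
Notation "x ∉ y" := (~ mem x y) (at level 70, no associativity) : zf_scope.

(* First-order formulas in de Bruijn style: variable [i] is read at position [i]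
   of the environment, and a quantifier binds variable 0. *)

Inductive formula : Type :=
| fMem (i j : nat)
| fEq (i j : nat)
| fBot
| fImp (p q : formula)
| fAnd (p q : formula)
| fOr (p q : formula)
| fAll (p : formula)
| fEx (p : formula).

Definition scons {T : Type} (x : T) (rho : nat -> T) : nat -> T :=
  fun n => match n with O => x | S k => rho k end.

Fixpoint sat (M : set_structure) (rho : nat -> M) (p : formula) : Prop :=
  match p with
  | fMem i j => rho i ∈ rho j
  | fEq i j => rho i = rho j
  | fBot => False
  | fImp p q => sat M rho p -> sat M rho q
  | fAnd p q => sat M rho p /\ sat M rho q
  | fOr p q => sat M rho p \/ sat M rho q
  | fAll p => forall x : M, sat M (scons x rho) p
  | fEx p => exists x : M, sat M (scons x rho) p
  end.

Definition subset {M : set_structure} (a b : M) : Prop :=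
  forall z : M, z ∈ a -> z ∈ b.
Notation "a ⊆ b" := (subset a b) (at level 70, no associativity) : zf_scope.

Definition is_empty {M : set_structure} (e : M) : Prop :=
  forall z : M, z ∉ e.

Definition nonempty {M : set_structure} (a : M) : Prop :=
  exists z : M, z ∈ a.

Definition is_upair {M : set_structure} (p x y : M) : Prop :=
  forall z : M, z ∈ p <-> z = x \/ z = y.

Definition is_union {M : set_structure} (u a : M) : Prop :=
  forall z : M, z ∈ u <-> exists y : M, y ∈ a /\ z ∈ y.

Definition is_powerset {M : set_structure} (p a : M) : Prop :=
  forall z : M, z ∈ p <-> z ⊆ a.

Definition is_inter {M : set_structure} (c a b : M) : Prop :=
  forall z : M, z ∈ c <-> z ∈ a /\ z ∈ b.

Definition is_diff {M : set_structure} (c a b : M) : Prop :=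
  forall z : M, z ∈ c <-> z ∈ a /\ z ∉ b.

Definition is_succ {M : set_structure} (s x : M) : Prop :=
  forall z : M, z ∈ s <-> z ∈ x \/ z = x.

Definition inductive {M : set_structure} (a : M) : Prop :=
  (exists e : M, is_empty e /\ e ∈ a) /\
  (forall x : M, x ∈ a -> exists s : M, is_succ s x /\ s ∈ a).

Record ZF (M : set_structure) : Prop := {
  zf_extensionality : forall a b : M, (forall z : M, z ∈ a <-> z ∈ b) -> a = b;
  zf_foundation : forall a : M, nonempty a ->
    exists x : M, x ∈ a /\ forall z : M, z ∈ x -> z ∉ a;
  zf_pairing : forall x y : M, exists p : M, is_upair p x y;
  zf_union : forall a : M, exists u : M, is_union u a;
  zf_powerset : forall a : M, exists p : M, is_powerset p a;
  zf_infinity : exists a : M, inductive a;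
  zf_separation : forall (p : formula) (rho : nat -> M) (a : M),
    exists b : M, forall x : M, x ∈ b <-> x ∈ a /\ sat M (scons x rho) p;
  zf_replacement : forall (p : formula) (rho : nat -> M) (a : M),
    (forall x y y' : M, x ∈ a ->
       sat M (scons y (scons x rho)) p -> sat M (scons y' (scons x rho)) p ->
       y = y') ->
    exists b : M, forall y : M,
      y ∈ b <-> exists x : M, x ∈ a /\ sat M (scons y (scons x rho)) p
}.

(* Kuratowski pairs; functions are sets of pairs. *)

Definition is_pair {M : set_structure} (p x y : M) : Prop :=
  exists u v : M, is_upair u x x /\ is_upair v x y /\ is_upair p u v.

Definition is_product {M : set_structure} (p a b : M) : Prop :=
  forall z : M, z ∈ p <-> exists x y : M, x ∈ a /\ y ∈ b /\ is_pair z x y.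

(* [rel f x y]: the pair (x, y) is in f; for a function f it says f(x) = y. *)
Definition rel {M : set_structure} (f x y : M) : Prop :=
  exists p : M, is_pair p x y /\ p ∈ f.

(* [rel2 f x y z]: f(x, y) = z. *)
Definition rel2 {M : set_structure} (f x y z : M) : Prop :=
  exists p : M, is_pair p x y /\ rel f p z.

Definition is_function {M : set_structure} (f a b : M) : Prop :=
  (forall p : M, p ∈ f -> exists x y : M, x ∈ a /\ y ∈ b /\ is_pair p x y) /\
  (forall x : M, x ∈ a -> exists! y : M, rel f x y).

Definition is_function2 {M : set_structure} (f a b c : M) : Prop :=
  exists p : M, is_product p a b /\ is_function f p c.

Definition is_bijection {M : set_structure} (f a b : M) : Prop :=
  is_function f a b /\ (forall y : M, y ∈ b -> exists! x : M, rel f x y).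

Definition equipotent {M : set_structure} (a b : M) : Prop :=
  exists f : M, is_bijection f a b.

Definition is_omega {M : set_structure} (w : M) : Prop :=
  inductive w /\ forall a : M, inductive a -> w ⊆ a.

Definition finite {M : set_structure} (a : M) : Prop :=
  exists w n : M, is_omega w /\ n ∈ w /\ equipotent a n.

Definition infinite {M : set_structure} (a : M) : Prop := ~ finite a.

Definition countable {M : set_structure} (a : M) : Prop :=
  exists w s : M, is_omega w /\ s ⊆ w /\ equipotent a s.

Definition uncountable {M : set_structure} (a : M) : Prop := ~ countable a.

Definition denumerable {M : set_structure} (a : M) : Prop :=
  countable a /\ infinite a.

(* The real line of [M]: a Dedekind-complete ordered field in [M].  ZF proves
   that one exists and that it is unique up to isomorphism. *)

Record field_data (M : set_structure) : Type := FieldData {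
  Rset : M;
  Radd : M;
  Rmul : M;
  Rle : M;
  Rzero : M;
  Rone : M
}.

Definition leR {M : set_structure} (R : field_data M) (x y : M) : Prop :=
  rel (Rle R) x y.
Definition ltR {M : set_structure} (R : field_data M) (x y : M) : Prop :=
  leR R x y /\ x <> y.

Record is_field {M : set_structure} (R : field_data M) : Prop := {
  add_function : is_function2 (Radd R) (Rset R) (Rset R) (Rset R);
  mul_function : is_function2 (Rmul R) (Rset R) (Rset R) (Rset R);
  zero_in : Rzero R ∈ Rset R;
  one_in : Rone R ∈ Rset R;
  one_neq_zero : Rone R <> Rzero R;
  add_comm : forall x y s : M, rel2 (Radd R) x y s -> rel2 (Radd R) y x s;
  add_assoc : forall x y z xy yz s : M,
    rel2 (Radd R) x y xy -> rel2 (Radd R) y z yz ->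
    rel2 (Radd R) xy z s -> rel2 (Radd R) x yz s;
  add_zero : forall x : M, x ∈ Rset R -> rel2 (Radd R) x (Rzero R) x;
  add_inverse : forall x : M, x ∈ Rset R ->
    exists y : M, y ∈ Rset R /\ rel2 (Radd R) x y (Rzero R);
  mul_comm : forall x y p : M, rel2 (Rmul R) x y p -> rel2 (Rmul R) y x p;
  mul_assoc : forall x y z xy yz p : M,
    rel2 (Rmul R) x y xy -> rel2 (Rmul R) y z yz ->
    rel2 (Rmul R) xy z p -> rel2 (Rmul R) x yz p;
  mul_one : forall x : M, x ∈ Rset R -> rel2 (Rmul R) x (Rone R) x;
  mul_inverse : forall x : M, x ∈ Rset R -> x <> Rzero R ->
    exists y : M, y ∈ Rset R /\ rel2 (Rmul R) x y (Rone R);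
  mul_add_distr : forall x y z yz xy xz p : M,
    rel2 (Radd R) y z yz -> rel2 (Rmul R) x y xy -> rel2 (Rmul R) x z xz ->
    rel2 (Rmul R) x yz p -> rel2 (Radd R) xy xz p
}.

Record is_ordered_field {M : set_structure} (R : field_data M) : Prop := {
  ordered_field_field : is_field R;
  le_refl : forall x : M, x ∈ Rset R -> leR R x x;
  le_antisym : forall x y : M, x ∈ Rset R -> y ∈ Rset R ->
    leR R x y -> leR R y x -> x = y;
  le_trans : forall x y z : M, x ∈ Rset R -> y ∈ Rset R -> z ∈ Rset R ->
    leR R x y -> leR R y z -> leR R x z;
  le_total : forall x y : M, x ∈ Rset R -> y ∈ Rset R -> leR R x y \/ leR R y x;
  le_add : forall x y z xz yz : M, x ∈ Rset R -> y ∈ Rset R -> z ∈ Rset R ->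
    leR R x y -> rel2 (Radd R) x z xz -> rel2 (Radd R) y z yz -> leR R xz yz;
  le_mul : forall x y p : M, x ∈ Rset R -> y ∈ Rset R ->
    leR R (Rzero R) x -> leR R (Rzero R) y -> rel2 (Rmul R) x y p ->
    leR R (Rzero R) p
}.

Definition upper_bound {M : set_structure} (R : field_data M) (s b : M) : Prop :=
  b ∈ Rset R /\ forall x : M, x ∈ s -> leR R x b.

Definition is_real_line {M : set_structure} (R : field_data M) : Prop :=
  is_ordered_field R /\
  forall s : M, s ⊆ Rset R -> nonempty s -> (exists b : M, upper_bound R s b) ->
    exists l : M, upper_bound R s l /\
      forall b : M, upper_bound R s b -> leR R l b.

Definition CAC_R {M : set_structure} (R : field_data M) : Prop :=
  forall F : M, denumerable F ->
    (forall a : M, a ∈ F -> a ⊆ Rset R /\ nonempty a) ->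
    exists f : M, is_function f F (Rset R) /\
      forall a x : M, a ∈ F -> rel f a x -> x ∈ a.

Record space (M : set_structure) : Type := Space {
  points : M;
  opens : M
}.

Record is_topology {M : set_structure} (X : space M) : Prop := {
  open_subset : forall u : M, u ∈ opens X -> u ⊆ points X;
  open_empty : forall e : M, is_empty e -> e ∈ opens X;
  open_points : points X ∈ opens X;
  open_inter : forall u v i : M, u ∈ opens X -> v ∈ opens X ->
    is_inter i u v -> i ∈ opens X;
  open_union : forall s u : M, s ⊆ opens X -> is_union u s -> u ∈ opens X
}.

Definition closed_set {M : set_structure} (X : space M) (c : M) : Prop :=
  c ⊆ points X /\ exists u : M, u ∈ opens X /\ is_diff u (points X) c.

Definition in_closure {M : set_structure} (X : space M) (a x : M) : Prop :=
  x ∈ points X /\ forall c : M, closed_set X c -> a ⊆ c -> x ∈ c.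

Definition hausdorff {M : set_structure} (X : space M) : Prop :=
  forall x y : M, x ∈ points X -> y ∈ points X -> x <> y ->
    exists u v : M, u ∈ opens X /\ v ∈ opens X /\ x ∈ u /\ y ∈ v /\
      forall z : M, z ∈ u -> z ∉ v.

Definition covers {M : set_structure} (s a : M) : Prop :=
  forall x : M, x ∈ a -> exists u : M, u ∈ s /\ x ∈ u.

Definition compact_set {M : set_structure} (X : space M) (k : M) : Prop :=
  k ⊆ points X /\
  forall s : M, s ⊆ opens X -> covers s k ->
    exists t : M, t ⊆ s /\ finite t /\ covers t k.

Definition is_base {M : set_structure} (X : space M) (b : M) : Prop :=
  b ⊆ opens X /\
  forall u x : M, u ∈ opens X -> x ∈ u -> exists v : M, v ∈ b /\ x ∈ v /\ v ⊆ u.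

Definition second_countable {M : set_structure} (X : space M) : Prop :=
  exists b : M, is_base X b /\ countable b.

Record is_metric {M : set_structure} (R : field_data M) (d a : M) : Prop := {
  metric_function : is_function2 d a a (Rset R);
  metric_nonneg : forall x y r : M, rel2 d x y r -> leR R (Rzero R) r;
  metric_zero : forall x y : M, x ∈ a -> y ∈ a ->
    (rel2 d x y (Rzero R) <-> x = y);
  metric_sym : forall x y r : M, rel2 d x y r -> rel2 d y x r;
  metric_triangle : forall x y z dxy dyz dxz s : M,
    rel2 d x y dxy -> rel2 d y z dyz -> rel2 d x z dxz ->
    rel2 (Radd R) dxy dyz s -> leR R dxz s
}.

Definition metrizable {M : set_structure} (R : field_data M) (X : space M) : Prop :=
  exists d : M, is_metric R d (points X) /\
    forall u : M, u ∈ opens X <->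
      u ⊆ points X /\
      forall x : M, x ∈ u ->
        exists r : M, r ∈ Rset R /\ ltR R (Rzero R) r /\
          forall y s : M, rel2 d x y s -> ltR R s r -> y ∈ u.

Definition second_countable_metrizable {M : set_structure} (R : field_data M)
    (X : space M) : Prop :=
  is_topology X /\ second_countable X /\ metrizable R X.

Definition is_subspace {M : set_structure} (Y X : space M) : Prop :=
  points Y ⊆ points X /\
  forall v : M, v ∈ opens Y <->
    exists u : M, u ∈ opens X /\ is_inter v u (points Y).

Definition k_space {M : set_structure} (X : space M) : Prop :=
  hausdorff X /\
  forall a : M, a ⊆ points X ->
    (forall k i : M, compact_set X k -> is_inter i a k -> closed_set X i) ->
    closed_set X a.

Definition every_subspace_k_space {M : set_structure} (X : space M) : Prop :=
  forall Y : space M, is_subspace Y X -> k_space Y.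

(* On omega, whose elements are von Neumann numerals, n <= m is n ⊆ m. *)
Definition converges_to {M : set_structure} (X : space M) (w s x : M) : Prop :=
  forall u : M, u ∈ opens X -> x ∈ u ->
    exists n : M, n ∈ w /\
      forall m y : M, m ∈ w -> n ⊆ m -> rel s m y -> y ∈ u.

Definition frechet_urysohn {M : set_structure} (X : space M) : Prop :=
  forall a x : M, a ⊆ points X -> in_closure X a x ->
    exists w s : M, is_omega w /\ is_function s w a /\ converges_to X w s x.

Definition uncountable_subsets_contain_infinite_closed {M : set_structure}
    (X : space M) : Prop :=
  forall a : M, a ⊆ points X -> uncountable a ->
    exists c : M, c ⊆ a /\ infinite c /\ closed_set X c.

(* Main.v *)
From HB Require Import structures.
From mathcomp Require Import all_boot all_order all_algebra boolp lra.
Require Import Defs.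
Set Implicit Arguments.
Unset Strict Implicit.
Unset Printing Implicit Defensive.

(** The work is done inside a model [M] of ZF, where a set can be formed only if
    a first-order formula with parameters in [M] defines it, and where no choice
    is available.  Classical logic and choice in the metatheory are harmless:
    they name objects of [M] but do not put functions into [M].

    Definability is handled once and for all: the predicates definable with
    parameters are closed under the logical operations, quantification over [M]
    and substitution of definable terms, so that a syntax-directed tactic,
    [definability], proves every instance of Separation that occurs.

    The Fréchet-Urysohn property gives the [k]-property of every subspace because
    a convergent sequence with its limit is compact
    ([frechet_urysohn_subspaces_k]).  Conversely let [x] be a limit point of [a]
    outside [a].  The set [a] is not closed in the subspace [a ∪ {x}], and
    a compact [k] witnesses this.  Second countability lets one choose from the
    closed subsets of [k] without any choice principle: a point [z] has as code the
    set of indices of the basic open sets to whose closure it belongs, the codes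
    separate points, and by compactness every nonempty closed set contains a point
    with lexicographically largest code ([lex_maximum_exists]).  Since [k] has
    a countable network of closed sets, this selects a sequence in [a] that
    converges to [x] ([k_space_sequence]).  Of a metric only the Hausdorff property
    is used here.

    For the infinite closed subsets: if every point of [A] is isolated in [A], then
    basic open sets name the points of [A] and [A] is countable.  Otherwise some
    point of [A] is the limit of a sequence of other points of [A], and this
    sequence with its limit is closed and infinite
    ([frechet_urysohn_infinite_closed]).

    [CAC(R)] implies that all second countable metrizable spaces are
    Fréchet-Urysohn, because points are coded by sets of indices of basic open
    sets, and sets of natural numbers by reals through the Cantor map, which sends
    [S] to the sum of [3^-n] over [n ∈ S] ([choice_frechet_urysohn]).  Conversely,
    given a countable family of nonempty sets of reals, code each choice function
    for an initial segment of the family, together with the length of the segment,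
    by a real that is small when the segment is long and bounded away from [0] when
    the length is fixed.  In the subspace of the line that consists of [0] and
    these codes, [0] is a limit point; if this space is a [k]-space, a sequence of
    codes converges to [0], the lengths tend to infinity, and the first code in the
    sequence that is long enough supplies the choice for each member of the family
    ([k_spaces_choice]).  So the [k]-property of all second countable metrizable
    spaces gives back the property for all their subspaces. *)

(** * Definability with parameters *)

Record zf_model := ZfModel {
  zf_structure :> set_structure;
  zf_axioms : ZF zf_structure
}.

Section Definability.
Variable M : zf_model.

(** The values of [n] free variables, as nested pairs: entering a quantifier then
    amounts to pairing, and a predicate in context is an ordinary function. *)
Fixpoint ctx (n : nat) : Type :=
  match n with O => unit | S k => (ctx k * M)%type end.

Fixpoint env (n : nat) : ctx n -> (nat -> M) -> nat -> M :=
  match n with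
  | O => fun _ e => e
  | S k => fun c e => scons (snd c) (env (fst c) e)
  end.

(** The sequence [e] holds the parameters; it extends the free variables to an
    environment. *)
Definition definable (n : nat) (P : ctx n -> Prop) : Prop :=
  exists p e, forall c, P c <-> sat M (env c e) p.

Definition definable_term (n : nat) (t : ctx n -> M) : Prop :=
  @definable n.+1 (fun c : ctx n * M => snd c = t (fst c)).

Definition up (f : nat -> nat) (i : nat) : nat :=
  match i with O => O | S k => S (f k) end.

Fixpoint rename (f : nat -> nat) (p : formula) : formula :=
  match p with
  | fMem i j => fMem (f i) (f j)
  | fEq i j => fEq (f i) (f j)
  | fBot => fBot
  | fImp p q => fImp (rename f p) (rename f q)
  | fAnd p q => fAnd (rename f p) (rename f q)
  | fOr p q => fOr (rename f p) (rename f q)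
  | fAll p => fAll (rename (up f) p)
  | fEx p => fEx (rename (up f) p)
  end.

Lemma sat_rename p : forall f (rho rho' : nat -> M),
  (forall i, rho' i = rho (f i)) -> sat M rho (rename f p) <-> sat M rho' p.
Proof.
have step f (rho rho' : nat -> M) x : (forall i, rho' i = rho (f i)) ->
  forall i, scons x rho' i = scons x rho (up f i) by move=> h [].
elim: p => [i j|i j||p IHp q IHq|p IHp q IHq|p IHp q IHq|p IHp|p IHp]
  f rho rho' h /=; rewrite ?h //; try by have := IHp _ _ _ h; have := IHq _ _ _ h; tauto.
- by split=> H x; apply/(IHp _ _ _ (step _ _ _ x h)).
- by split=> -[x H]; exists x; apply/(IHp _ _ _ (step _ _ _ x h)).
Qed.

Lemma env_shift n (c : ctx n) e i : env c e (n + i) = e i.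
Proof. by elim: n c => [|n IH] //= [c x]; apply: IH. Qed.

Lemma definable_rename m n (P : ctx m -> Prop) (g : ctx n -> ctx m)
    (f : nat -> nat) :
  (forall c e i, env (g c) e i = env c e (f i)) ->
  definable P -> definable (fun c => P (g c)).
Proof.
move=> h [p [e H]]; exists (rename f p), e => c.
by rewrite H; apply: iff_sym; apply: sat_rename => i; apply: h.
Qed.

(** Two formulas may use different parameter sequences; interleaving these
    makes room for both. *)
Lemma definable_common n (P Q : ctx n -> Prop) :
  definable P -> definable Q ->
  exists p q e, forall c,
    (P c <-> sat M (env c e) p) /\ (Q c <-> sat M (env c e) q).
Proof.
move=> [p [e1 H1]] [q [e2 H2]].
pose place (b : bool) i := if (i < n)%N then i else (n + (b + (i - n).*2))%N.
pose e i := if odd i then e2 i./2 else e1 i./2.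
have low (c : ctx n) e' e'' i : (i < n)%N -> env c e' i = env c e'' i.
  by elim: {P Q H1 H2 place} n c i => [|n IH] //= [c x] [|i] //=; apply: IH.
exists (rename (place false) p), (rename (place true) q), e.
have upr (c : ctx n) (b : bool) e' i : (forall j, e (b + j.*2)%N = e' j) ->
    env c e' i = env c e (place b i).
  move=> he; rewrite /place; case: ltnP => hi; first exact: low.
  by rewrite env_shift he -{1}(subnKC hi) env_shift.
move=> c; split; [rewrite H1|rewrite H2]; apply: iff_sym; apply: sat_rename => i;
  apply: upr => j; rewrite /e /= ?odd_double ?doubleK //.
by rewrite uphalf_double.
Qed.

Lemma definable_ext n (P Q : ctx n -> Prop) :
  (forall c, P c <-> Q c) -> definable P -> definable Q.
Proof. by move=> h [p [e H]]; exists p, e => c; rewrite -h. Qed.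

Lemma definable_const n (P : Prop) : definable (fun _ : ctx n => P).
Proof.
have [x _] := zf_infinity (zf_axioms M).
by case: (pselect P) => h; [exists (fImp fBot fBot)|exists fBot];
  exists (fun=> x) => c /=; tauto.
Qed.

Lemma definable_imp n (P Q : ctx n -> Prop) : definable P -> definable Q ->
  definable (fun c => P c -> Q c).
Proof.
move=> dP dQ; have [p [q [e H]]] := definable_common dP dQ.
by exists (fImp p q), e => c /=; have := H c; tauto.
Qed.

Lemma definable_and n (P Q : ctx n -> Prop) : definable P -> definable Q ->
  definable (fun c => P c /\ Q c).
Proof.
move=> dP dQ; have [p [q [e H]]] := definable_common dP dQ.
by exists (fAnd p q), e => c /=; have := H c; tauto.
Qed.

Lemma definable_or n (P Q : ctx n -> Prop) : definable P -> definable Q ->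
  definable (fun c => P c \/ Q c).
Proof.
move=> dP dQ; have [p [q [e H]]] := definable_common dP dQ.
by exists (fOr p q), e => c /=; have := H c; tauto.
Qed.

Lemma definable_all n (P : ctx n -> M -> Prop) :
  @definable n.+1 (fun c : ctx n * M => P (fst c) (snd c)) ->
  definable (fun c => forall x, P c x).
Proof.
move=> [p [e H]]; exists (fAll p), e => c /=.
by split=> h x; have := H (c, x); move: (h x) => /=; tauto.
Qed.

Lemma definable_ex n (P : ctx n -> M -> Prop) :
  @definable n.+1 (fun c : ctx n * M => P (fst c) (snd c)) ->
  definable (fun c => exists x, P c x).
Proof.
move=> [p [e H]]; exists (fEx p), e => c /=.
by split=> -[x h]; exists x; have := H (c, x); move: h => /=; tauto.
Qed.

Lemma definable_weaken1 n (P : ctx n -> M -> Prop) :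
  @definable n.+1 (fun c : ctx n * M => P (fst c) (snd c)) ->
  @definable n.+2 (fun c : ctx n * M * M => P (fst (fst c)) (snd c)).
Proof.
apply: (@definable_rename n.+1 n.+2 (fun c : ctx n * M => P c.1 c.2)
  (fun c : ctx n * M * M => (c.1.1, c.2))
  (fun i => if i is i'.+1 then i'.+2 else 0%N)).
by move=> c e [].
Qed.

(** Fixing the free variables of a formula turns them into parameters. *)
Lemma definable_instance n (P : ctx n -> M -> Prop) (c : ctx n) :
  @definable n.+1 (fun c : ctx n * M => P (fst c) (snd c)) ->
  @definable 1 (fun d : unit * M => P c (snd d)).
Proof.
by move=> [p [e H]]; exists p, (env c e) => d; apply: (H (c, d.2)).
Qed.

Lemma definable_subst n (P : ctx n -> M -> Prop) (t : ctx n -> M) :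
  @definable n.+1 (fun c : ctx n * M => P (fst c) (snd c)) ->
  definable_term t -> definable (fun c => P c (t c)).
Proof.
move=> dP dt; have := @definable_ex n (fun c x => x = t c /\ P c x) (definable_and dt dP).
by apply: definable_ext => c; split=> [[x [-> //]]|h]; exists (t c).
Qed.

Lemma definable_subst1 n (Q : M -> Prop) (t : ctx n -> M) :
  @definable 1 (fun c : unit * M => Q (snd c)) ->
  definable_term t -> definable (fun c => Q (t c)).
Proof.
move=> dQ; apply: (@definable_subst n (fun _ x => Q x)).
apply: (@definable_rename 1 n.+1 (fun c : unit * M => Q c.2)
  (fun c : ctx n * M => (tt, c.2))
  (fun i => if i is i'.+1 then (n + i').+1 else 0%N)) => // c e [|i] //=.
by rewrite env_shift.
Qed.

Lemma definable_subst2 n (Q : M -> M -> Prop) (s t : ctx n -> M) :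
  @definable 2 (fun c : unit * M * M => Q (snd (fst c)) (snd c)) ->
  definable_term s -> definable_term t -> definable (fun c => Q (s c) (t c)).
Proof.
move=> dQ ds; apply: (@definable_subst n (fun c x => Q (s c) x)).
apply: (@definable_subst n.+1 (fun (c : ctx n * M) x => Q x (snd c))); last first.
  exact: (@definable_weaken1 n (fun c x => x = s c)).
apply: (@definable_rename 2 n.+2 (fun c : unit * M * M => Q c.1.2 c.2)
  (fun c : ctx n * M * M => (tt, c.2, c.1.2))
  (fun i => match i with 0 => 1 | 1 => 0 | i'.+2 => (n + i').+2 end)%N)
  => // c e [|[|i]] //=.
by rewrite env_shift.
Qed.

Lemma definable_subst3 n (Q : M -> M -> M -> Prop) (r s t : ctx n -> M) :
  @definable 3 (fun c : unit * M * M * M => Q (snd (fst (fst c))) (snd (fst c)) (snd c)) ->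
  definable_term r -> definable_term s -> definable_term t ->
  definable (fun c => Q (r c) (s c) (t c)).
Proof.
move=> dQ dr ds; apply: (@definable_subst n (fun c x => Q (r c) (s c) x)).
apply: (@definable_subst n.+1 (fun (c : ctx n * M) x => Q (r (fst c)) x (snd c))); last first.
  exact: (@definable_weaken1 n (fun c x => x = s c)).
apply: (@definable_subst n.+2
  (fun (c : ctx n * M * M) x => Q x (snd c) (snd (fst c)))); last first.
  apply: (@definable_weaken1 n.+1 (fun (c : ctx n * M) x => x = r (fst c))).
  exact: (@definable_weaken1 n (fun c x => x = r c)).
apply: (@definable_rename 3 n.+3 (fun c : unit * M * M * M => Q c.1.1.2 c.1.2 c.2)
  (fun c : ctx n * M * M * M => (tt, c.2, c.1.2, c.1.1.2))
  (fun i => match i with 0 => 2 | 1 => 1 | 2 => 0 | i'.+3 => (n + i').+3 end)%N)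
  => // c e [|[|[|i]]] //=.
by rewrite env_shift.
Qed.

Lemma definable_mem n (s t : ctx n -> M) : definable_term s -> definable_term t ->
  definable (fun c => s c ∈ t c).
Proof.
have [x _] := zf_infinity (zf_axioms M).
by apply: definable_subst2; exists (fMem 1 0), (fun=> x).
Qed.

Lemma definable_eq n (s t : ctx n -> M) : definable_term s -> definable_term t ->
  definable (fun c => s c = t c).
Proof.
have [x _] := zf_infinity (zf_axioms M).
by apply: definable_subst2; exists (fEq 1 0), (fun=> x).
Qed.

Lemma definable_term_const n (x : M) : definable_term (fun _ : ctx n => x).
Proof.
exists (fEq 0 n.+1), (fun=> x) => -[c y] /=.
by have := env_shift c (fun=> x) 0; rewrite addn0 => ->.
Qed.

Lemma definable_term_last n : @definable_term n.+1 (fun c : ctx n * M => snd c).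
Proof.
by have [x _] := zf_infinity (zf_axioms M); exists (fEq 0 1), (fun=> x) => -[c y].
Qed.

Lemma definable_term_weaken n (t : ctx n -> M) : definable_term t ->
  @definable_term n.+1 (fun c : ctx n * M => t (fst c)).
Proof. exact: (@definable_weaken1 n (fun c x => x = t c)). Qed.

Lemma definable_not n (P : ctx n -> Prop) : definable P ->
  definable (fun c => ~ P c).
Proof. by move=> dP; apply: definable_imp dP (definable_const _ _). Qed.

Lemma definable_iff n (P Q : ctx n -> Prop) : definable P -> definable Q ->
  definable (fun c => P c <-> Q c).
Proof. by move=> dP dQ; apply: definable_and; apply: definable_imp. Qed.

Lemma definable_term1 n (F : M -> M) (s : ctx n -> M) :
  @definable 2 (fun c : unit * M * M => snd c = F (snd (fst c))) ->
  definable_term s -> definable_term (fun c => F (s c)).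
Proof.
move=> dF ds; apply: (@definable_subst2 n.+1 (fun x y => y = F x)) => //.
  exact: definable_term_weaken.
exact: definable_term_last.
Qed.

Lemma definable_term2 n (F : M -> M -> M) (s t : ctx n -> M) :
  @definable 3 (fun c : unit * M * M * M =>
    snd c = F (snd (fst (fst c))) (snd (fst c))) ->
  definable_term s -> definable_term t -> definable_term (fun c => F (s c) (t c)).
Proof.
move=> dF ds dt; apply: (@definable_subst3 n.+1 (fun x y z => z = F x y)) => //.
- exact: definable_term_weaken.
- exact: definable_term_weaken.
- exact: definable_term_last.
Qed.

End Definability.

Arguments definable_term_last {M n}.
Arguments definable_term_const {M n} x.
Arguments definable_const {M n} P.

Ltac definability_var :=
  match goal with |- @definable_term ?M _ _ =>
    let rec go pf depth :=
      first [exact pf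
            | lazymatch depth with
              | S ?d => go uconstr:(definable_term_weaken pf) d
              end] in
    go uconstr:(definable_term_last) 9%nat
  end.

(** * Sets, pairs and functions in the model *)

Section SetOperations.
Variable M : zf_model.
Implicit Types a b e f g h k m n p q r s t u v w x y z : M.

Lemma ext a b : (forall z, z ∈ a <-> z ∈ b) -> a = b.
Proof. exact: (zf_extensionality (zf_axioms M)). Qed.

Definition upair x y : M := projT1 (cid (zf_pairing (zf_axioms M) x y)).
Definition union a : M := projT1 (cid (zf_union (zf_axioms M) a)).
Definition pow a : M := projT1 (cid (zf_powerset (zf_axioms M) a)).

Lemma mem_upair x y z : z ∈ upair x y <-> z = x \/ z = y.
Proof. exact: (projT2 (cid (zf_pairing (zf_axioms M) x y)) z). Qed.

Lemma mem_union a z : z ∈ union a <-> exists y, y ∈ a /\ z ∈ y.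
Proof. exact: (projT2 (cid (zf_union (zf_axioms M) a)) z). Qed.

Lemma mem_pow a z : z ∈ pow a <-> z ⊆ a.
Proof. exact: (projT2 (cid (zf_powerset (zf_axioms M) a)) z). Qed.

Lemma sep_subproof a (P : M -> Prop) : exists b : M,
  @definable M 1 (fun c : unit * M => P (snd c)) ->
  forall x, x ∈ b <-> x ∈ a /\ P x.
Proof.
have [[p [e H]]|nP] := pselect (@definable M 1 (fun c : unit * M => P (snd c))).
  have [b Hb] := zf_separation (zf_axioms M) p e a; exists b => _ x.
  by rewrite Hb (H (tt, x)).
by exists a.
Qed.

(** The subset is total in [P], so that it can be written before definability of
    [P] is established; for an indefinable [P] its value is arbitrary. *)
Definition sep a (P : M -> Prop) : M := projT1 (cid (sep_subproof a P)).

Lemma mem_sep a (P : M -> Prop) x :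
  @definable M 1 (fun c : unit * M => P (snd c)) ->
  x ∈ sep a P <-> x ∈ a /\ P x.
Proof. by move=> dP; apply: (projT2 (cid (sep_subproof a P)) dP x). Qed.

End SetOperations.

(* Rules for constants introduced later are added to this tactic; a constant
   without a rule is unfolded. *)
Ltac definability_hook := fail.

Ltac head_of t := lazymatch t with ?f _ => head_of f | _ => t end.
Ltac unfold_head h := let f := head_of h in progress (unfold f; cbv beta).
Ltac definability_unfold :=
  match goal with
  | |- _ (fun c => ?h (@?x c)) => unfold_head h
  | |- _ (fun c => ?h (@?x c) (@?y c)) => unfold_head h
  | |- _ (fun c => ?h (@?x c) (@?y c) (@?z c)) => unfold_head h
  | |- _ (fun c => ?h (@?x c) (@?y c) (@?z c) (@?t c)) => unfold_head h
  end.

Ltac definability_step :=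
  cbv beta;
  match goal with
  | |- definable (fun _ => ?P) => exact (definable_const P)
  | |- definable (fun c => @?P c /\ @?Q c) => refine (definable_and _ _)
  | |- definable (fun c => @?P c \/ @?Q c) => refine (definable_or _ _)
  | |- definable (fun c => @?P c <-> @?Q c) => refine (definable_iff _ _)
  | |- definable (fun c => ~ @?P c) => refine (definable_not _)
  | |- definable (fun c => ex _) => refine (definable_ex _)
  | |- definable (fun c => mem _ _) => refine (definable_mem _ _)
  | |- definable (fun c => _ = _) => refine (definable_eq _ _)
  | |- definable (fun c => forall x, _) =>
      first [refine (definable_imp _ _) | refine (definable_all _)]
  | H : @definable _ 1 (fun c => ?Q _) |- definable (fun c => ?Q _) =>
      refine (definable_subst1 H _)
  | H : @definable _ 2 (fun c => ?Q _ _) |- definable (fun c => ?Q _ _) =>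
      refine (definable_subst2 H _ _)
  | H : @definable _ 3 (fun c => ?Q _ _ _) |- definable (fun c => ?Q _ _ _) =>
      refine (definable_subst3 H _ _ _)
  | |- definable_term (fun _ => ?t) => exact (definable_term_const t)
  | |- definable_term _ => definability_var
  | |- _ => definability_hook
  | |- _ => definability_unfold
  end.
Ltac definability := repeat definability_step.

Section DefinableOperations.
Variable M : zf_model.
Implicit Types a b e f g h k m n p q r s t u v w x y z : M.

Lemma definable_term_upair (n : nat) (s t : ctx M n -> M) : definable_term s ->
  definable_term t -> definable_term (fun c => upair (s c) (t c)).
Proof.
apply: definable_term2.
apply: (@definable_ext _ 3 (fun c : unit * M * M * M =>
  forall z, z ∈ c.2 <-> z = c.1.1.2 \/ z = c.1.2)) => [c|]; last by definability.
split=> [h|->] *; last exact: mem_upair.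
by apply: ext => z; rewrite h mem_upair.
Qed.

Lemma definable_term_union (n : nat) (s : ctx M n -> M) : definable_term s ->
  definable_term (fun c => union (s c)).
Proof.
apply: definable_term1.
apply: (@definable_ext _ 2 (fun c : unit * M * M =>
  forall z, z ∈ c.2 <-> exists y, y ∈ c.1.2 /\ z ∈ y)) => [c|]; last by definability.
split=> [h|->] *; last exact: mem_union.
by apply: ext => z; rewrite h mem_union.
Qed.

Lemma definable_term_pow (n : nat) (s : ctx M n -> M) : definable_term s ->
  definable_term (fun c => pow (s c)).
Proof.
apply: definable_term1.
apply: (@definable_ext _ 2 (fun c : unit * M * M =>
  forall z, z ∈ c.2 <-> z ⊆ c.1.2)) => [c|]; last by definability.
split=> [h|->] *; last exact: mem_pow.
by apply: ext => z; rewrite h mem_pow.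
Qed.

Lemma definable_term_sep (n : nat) (s : ctx M n -> M) (P : ctx M n -> M -> Prop) :
  definable_term s ->
  @definable M n.+1 (fun c : ctx M n * M => P (fst c) (snd c)) ->
  definable_term (fun c => sep (s c) (P c)).
Proof.
move=> ds dP.
apply: (@definable_ext _ n.+1 (fun c : ctx M n * M =>
  forall z, z ∈ c.2 <-> z ∈ s c.1 /\ P c.1 z)) => [c|].
  have E z := mem_sep (s c.1) z (definable_instance c.1 dP).
  split=> [h|->] *; last exact: E.
  by apply: ext => z; rewrite h E.
refine (definable_all _); refine (definable_iff _ _); first by definability.
refine (definable_and _ _).
  apply: definable_mem; first by definability.
  exact: (definable_term_weaken (t := fun c : ctx M n.+1 => s c.1)
    (definable_term_weaken ds)).
exact: (definable_weaken1 dP).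
Qed.

End DefinableOperations.

Ltac definability_sets :=
  lazymatch goal with
  | |- definable_term (fun _ => upair _ _) => refine (definable_term_upair _ _)
  | |- definable_term (fun _ => union _) => refine (definable_term_union _)
  | |- definable_term (fun _ => pow _) => refine (definable_term_pow _)
  | |- definable_term (fun _ => sep _ _) => refine (definable_term_sep _ _)
  end.
Ltac definability_hook ::= definability_sets.

Section Pairs.
Variable M : zf_model.
Implicit Types a b e f g h k m n p q r s t u v w x y z : M.

Lemma empty_exists : exists e : M, is_empty e.
Proof. by have [a [[e [? _]] _]] := zf_infinity (zf_axioms M); exists e. Qed.

Definition zero : M := projT1 (cid empty_exists).
Lemma mem_zero x : x ∉ zero.
Proof. exact: (projT2 (cid empty_exists) x). Qed.

Definition opair x y := upair (upair x x) (upair x y).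
Definition cup a b := union (upair a b).
Definition succ x := cup x (upair x x).
Definition prod a b := sep (pow (pow (cup a b)))
  (fun z => exists x y, x ∈ a /\ y ∈ b /\ z = opair x y).
(** The union of the set of all [y] with [(x, y)] in [f]: when there is a single
    such [y] this is the value, and the term is total and definable. *)
Definition app f x := union (sep (union (union f)) (fun y => opair x y ∈ f)).
End Pairs.
Arguments zero {M}.

Section DefinablePairs.
Variable M : zf_model.

Lemma definable_term_opair (n : nat) (s t : ctx M n -> M) : definable_term s ->
  definable_term t -> definable_term (fun c => opair (s c) (t c)).
Proof. by apply: definable_term2; definability. Qed.

Lemma definable_term_app (n : nat) (s t : ctx M n -> M) : definable_term s ->
  definable_term t -> definable_term (fun c => app (s c) (t c)).
Proof. by apply: definable_term2; definability. Qed.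

End DefinablePairs.
Ltac definability_pairs :=
  lazymatch goal with
  | |- definable_term (fun _ => opair _ _) => refine (definable_term_opair _ _)
  | |- definable_term (fun _ => app _ _) => refine (definable_term_app _ _)
  end.
Ltac definability_hook ::= first [definability_pairs | definability_sets].
Ltac rewrite_sep := rewrite mem_sep; last by definability.
Section PairLemmas.
Variable M : zf_model.
Implicit Types a b e f g h k m n p q r s t u v w x y z : M.
Lemma mem_cup a b x : x ∈ cup a b <-> x ∈ a \/ x ∈ b.
Proof.
rewrite mem_union; split=> [[y []]|]; first by rewrite mem_upair => -[]-> ; tauto.
by case=> h; [exists a|exists b]; rewrite mem_upair; tauto.
Qed.

Lemma mem_succ x y : y ∈ succ x <-> y ∈ x \/ y = x.
Proof. by rewrite mem_cup mem_upair; tauto. Qed.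

Lemma upair_inj1 x y z : upair x y = upair z z -> x = z /\ y = z.
Proof.
move=> e; have hx : x ∈ upair z z by rewrite -e mem_upair; left.
have : y ∈ upair z z by rewrite -e mem_upair; right.
by move: hx; rewrite !mem_upair; tauto.
Qed.

Lemma opair_inj x y x' y' : opair x y = opair x' y' -> x = x' /\ y = y'.
Proof.
move=> e.
have ex : x = x'.
  have : upair x x ∈ opair x' y' by rewrite -e mem_upair; left.
  by rewrite mem_upair => -[/upair_inj1[]|/esym /upair_inj1[]].
subst x'; split=> //.
have h1 : upair x y ∈ opair x y' by rewrite -e mem_upair; right.
have h2 : upair x y' ∈ opair x y by rewrite e mem_upair; right.
move: h1 h2; rewrite !mem_upair => -[/upair_inj1[_ ->]|h _].
  by case=> /upair_inj1[].
have : y ∈ upair x y' by rewrite -h mem_upair; right.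
have : y' ∈ upair x y by rewrite h mem_upair; right.
by rewrite !mem_upair => -[->|->] // [->|->].
Qed.

Lemma is_upairE p x y : is_upair p x y <-> p = upair x y.
Proof.
split=> [h|->]; last by move=> z; rewrite mem_upair.
by apply: ext => z; rewrite mem_upair; apply: h.
Qed.

Lemma is_pairE p x y : is_pair p x y <-> p = opair x y.
Proof.
split=> [[u [v]]|->]; first by rewrite !is_upairE => -[-> [->]].
by exists (upair x x), (upair x y); rewrite !is_upairE.
Qed.

Lemma relE f x y : rel f x y <-> opair x y ∈ f.
Proof.
split=> [[p []]|h]; first by rewrite is_pairE => ->.
by exists (opair x y); rewrite is_pairE.
Qed.

Lemma mem_prod a b z : z ∈ prod a b <-> exists x y, x ∈ a /\ y ∈ b /\ z = opair x y.
Proof.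
rewrite_sep.
split=> [[]//|[x [y [hx [hy ->]]]]]; split; last by exists x, y.
by rewrite mem_pow => u; rewrite mem_upair mem_pow => -[]-> t;
  rewrite mem_upair mem_cup => -[]->; tauto.
Qed.

Lemma mem_opair_prod a b x y : opair x y ∈ prod a b <-> x ∈ a /\ y ∈ b.
Proof.
rewrite mem_prod; split=> [[x' [y' [? [? /opair_inj[-> ->]]]]]//|[? ?]].
by exists x, y.
Qed.

End PairLemmas.

Section Functions.
Variable M : zf_model.
Implicit Types a b e f g h k m n p q r s t u v w x y z : M.

Lemma definable_rel (n : nat) (f x y : ctx M n -> M) : definable_term f ->
  definable_term x -> definable_term y ->
  definable (fun c => rel (f c) (x c) (y c)).
Proof.
apply: definable_subst3.
by apply: definable_ext => [c|]; [apply: iff_sym; apply: relE|definability].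
Qed.

Lemma rel_app f x y : (forall y', rel f x y' -> y' = y) -> rel f x y ->
  app f x = y.
Proof.
move=> uy; rewrite relE => h; apply: ext => z; rewrite mem_union; split.
  by case=> y' []; rewrite_sep => -[_] /relE /uy ->.
move=> hz; exists y; split=> //; rewrite_sep; split=> //.
rewrite mem_union; exists (upair x y); rewrite mem_upair mem_union; split; last by right.
by exists (opair x y); split=> //; rewrite mem_upair; right.
Qed.

Section IsFunction.
Variables f a b : M.
Hypothesis hf : is_function f a b.

Lemma app_rel x : x ∈ a -> rel f x (app f x).
Proof. by move=> /(proj2 hf)[y [h u]]; rewrite (@rel_app f x y) // => y' /u ->. Qed.

Lemma rel_dom x y : rel f x y -> x ∈ a /\ y ∈ b.
Proof.
rewrite relE => /(proj1 hf) [x' [y' [? [?]]]].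
by rewrite is_pairE => /opair_inj[-> ->].
Qed.

Lemma app_cod x : x ∈ a -> app f x ∈ b.
Proof. by move=> /app_rel /rel_dom[]. Qed.

Lemma rel_function x y : rel f x y <-> x ∈ a /\ app f x = y.
Proof.
split=> [h|[h <-]]; last exact: app_rel.
have [hx _] := rel_dom h; split=> //.
have [z [_ uz]] := proj2 hf _ hx.
by rewrite -(uz _ h) (uz _ (app_rel hx)).
Qed.
End IsFunction.

(** The usual way to put a function into the model: [Q] is any definable description
    of the values that determines them. *)
Lemma function_of_relation a b (Q : M -> M -> Prop) :
  @definable M 2 (fun c : unit * M * M => Q (snd (fst c)) (snd c)) ->
  (forall x, x ∈ a -> exists y, y ∈ b /\ Q x y) ->
  (forall x y y', x ∈ a -> y ∈ b -> y' ∈ b -> Q x y -> Q x y' -> y = y') ->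
  exists f, is_function f a b /\ (forall x, x ∈ a -> Q x (app f x)).
Proof.
move=> dQ tot uni.
pose f := sep (prod a b) (fun z => exists x y, z = opair x y /\ Q x y).
have fE x y : rel f x y <-> (x ∈ a /\ y ∈ b) /\ Q x y.
  rewrite relE /f; rewrite_sep; rewrite mem_opair_prod.
  split=> [[h [x' [y' [/opair_inj[<- <-]]]]]//|[h q]].
  by split=> //; exists x, y.
have hf : is_function f a b.
  split=> [p|x hx].
    rewrite /f; rewrite_sep; rewrite mem_prod => -[[x [y [? [? ->]]]] _].
    by exists x, y; rewrite is_pairE.
  have [y [hy q]] := tot x hx; exists y; split; first by rewrite fE.
  by move=> y'; rewrite fE => -[[_ hy'] q']; apply: (uni x).
by exists f; split=> // x hx; have := app_rel hf hx; rewrite fE => -[].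
Qed.

End Functions.

(** * Natural numbers of the model *)

Section Omega.
Variable M : zf_model.
Implicit Types a b e f g h k m n p q r s t u v w x y z : M.

Lemma is_emptyE (e : M) : is_empty e <-> e = zero.
Proof.
split=> [h|->]; last exact: mem_zero.
by apply: ext => z; split=> [/h|/mem_zero].
Qed.

Lemma is_succE s x : is_succ s x <-> s = succ x.
Proof.
split=> [h|-> z]; last exact: mem_succ.
by apply: ext => z; rewrite mem_succ; apply: h.
Qed.

Lemma inductiveE a :
  inductive a <-> zero ∈ a /\ (forall x, x ∈ a -> succ x ∈ a).
Proof.
split=> [[[e []]]|[h0 hS]].
  by rewrite is_emptyE => -> h0 hS; split=> // x /hS[s []]; rewrite is_succE => ->.
split; first by exists zero; rewrite is_emptyE.
by move=> x /hS hx; exists (succ x); rewrite is_succE.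
Qed.

Definition omega : M := sep (projT1 (cid (zf_infinity (zf_axioms M))))
  (fun x => forall a, zero ∈ a /\ (forall x, x ∈ a -> succ x ∈ a) -> x ∈ a).

Lemma mem_omega x : x ∈ omega <-> forall a, inductive a -> x ∈ a.
Proof.
rewrite /omega; case: (cid _) => w hw /=; rewrite_sep; split=> [[_ h] a|h].
  by rewrite inductiveE => /h.
by split=> [|a]; rewrite -?inductiveE; apply: h.
Qed.

Lemma omega_zero : zero ∈ omega.
Proof. by rewrite mem_omega => a /inductiveE[]. Qed.

Lemma omega_succ n : n ∈ omega -> succ n ∈ omega.
Proof. by rewrite !mem_omega => h a ha; have /inductiveE[_] := ha; apply; apply: h. Qed.

Lemma is_omegaE (w : M) : is_omega w <-> w = omega.
Proof.
have h : is_omega omega.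
  split; first by rewrite inductiveE; split; [exact: omega_zero|exact: omega_succ].
  by move=> a ha x /mem_omega; apply.
split=> [[h1 h2]|->] //; case: h => h3 h4.
by apply: ext => z; split; [apply: h2|apply: h4].
Qed.

Lemma omega_ind (P : M -> Prop) :
  @definable M 1 (fun c : unit * M => P (snd c)) ->
  P zero -> (forall n, n ∈ omega -> P n -> P (succ n)) ->
  forall n, n ∈ omega -> P n.
Proof.
move=> dP P0 PS n hn.
have : inductive (sep omega P).
  rewrite inductiveE; split; first by rewrite_sep; split=> //; exact: omega_zero.
  by move=> x; rewrite_sep => -[hx px]; rewrite_sep; split; [apply: omega_succ|apply: PS].
by move: (hn); rewrite mem_omega => h /h; rewrite_sep => -[].
Qed.

Lemma mem_irrefl x : x ∉ x.
Proof.
move=> h; have [|y []] := @zf_foundation _ (zf_axioms M) (upair x x).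
  by exists x; rewrite mem_upair; left.
by rewrite mem_upair => e /(_ x); case: e => -> /(_ h); rewrite mem_upair; apply; left.
Qed.

Lemma omega_trans n k : n ∈ omega -> k ∈ n -> k ∈ omega.
Proof.
move=> hn; move: n hn k; apply: omega_ind; first by definability.
  by move=> k /mem_zero.
by move=> n hn IH k; rewrite mem_succ => -[/IH|->].
Qed.

Lemma nat_trans n m k : n ∈ omega -> m ∈ n -> k ∈ m -> k ∈ n.
Proof.
move=> hn; move: n hn m k; apply: omega_ind; first by definability.
  by move=> m k /mem_zero.
move=> n hn IH m k; rewrite !mem_succ => -[h1 h2|->]; last by left.
by left; apply: (IH m).
Qed.

Lemma zero_mem_succ n : n ∈ omega -> zero ∈ succ n.
Proof.
move: n; apply: omega_ind; first by definability.
  by rewrite mem_succ; right.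
by move=> n hn h; rewrite mem_succ; left.
Qed.

Lemma succ_mem_succ n m : n ∈ omega -> m ∈ n -> succ m ∈ succ n.
Proof.
move=> hn; move: n hn m; apply: omega_ind; first by definability.
  by move=> m /mem_zero.
move=> n hn IH m; rewrite mem_succ => -[/IH h|->]; rewrite mem_succ; last by right.
by left.
Qed.

Lemma nat_total m n : m ∈ omega -> n ∈ omega -> m ∈ n \/ m = n \/ n ∈ m.
Proof.
move=> hm; move: n; apply: omega_ind; first by definability.
  move: m hm; apply: omega_ind; [by definability|by right; left|move=> m hm _].
  by do 2 right; apply: zero_mem_succ.
move=> n hn [h|[->|h]].
- by left; rewrite mem_succ; left.
- by left; rewrite mem_succ; right.
- by have := succ_mem_succ hm h; rewrite mem_succ => -[]; [right; right|right; left].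
Qed.

Lemma nat_subset m n : m ∈ omega -> n ∈ omega -> m ⊆ n <-> m ∈ succ n.
Proof.
move=> hm hn; rewrite mem_succ; split=> [h|[h|->]] //; last first.
  by move=> k; apply: nat_trans.
by have [|[|/h /mem_irrefl]] := nat_total hm hn; tauto.
Qed.

Lemma nat_not_mem m n : m ∈ omega -> n ∈ omega -> ~ m ∈ n <-> n ∈ succ m.
Proof.
move=> hm hn; rewrite mem_succ; split=> [|[h1 h2|->]].
- by have := nat_total hm hn; intuition.
- by have /mem_irrefl := nat_trans hm h1 h2.
- exact: mem_irrefl.
Qed.

(** Foundation yields a minimal element, which is least because the order is
    total. *)
Lemma omega_least (P : M -> Prop) n :
  @definable M 1 (fun c : unit * M => P (snd c)) ->
  n ∈ omega -> P n ->
  exists m, m ∈ omega /\ P m /\ (forall k, k ∈ m -> ~ P k).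
Proof.
move=> dP hn pn; have [|m []] := @zf_foundation _ (zf_axioms M) (sep omega P).
  by exists n; rewrite_sep.
rewrite_sep => -[hm pm] h; exists m; split=> //; split=> // k hk pk.
by apply: (h k hk); rewrite_sep; split=> //; apply: omega_trans hk.
Qed.

Lemma nat_case n : n ∈ omega -> n = zero \/ exists m, m ∈ omega /\ n = succ m.
Proof.
move: n; apply: omega_ind; [by definability|by left|move=> n hn _; right].
by exists n.
Qed.

Lemma succ_inj m n : m ∈ omega -> n ∈ omega -> succ m = succ n -> m = n.
Proof.
move=> hm hn e.
have : m ∈ succ n by rewrite -e mem_succ; right.
have : n ∈ succ m by rewrite e mem_succ; right.
rewrite !mem_succ => -[h1|->] // [h2|] //.
by have /mem_irrefl := nat_trans hm h1 h2.
Qed.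

Lemma zero_not_succ n : zero <> succ n.
Proof. by move=> e; apply: (@mem_zero _ n); rewrite e mem_succ; right. Qed.

(** The graph of the recursively defined function is the least relation closed
    under the recursion step. *)
Lemma recursion B a (Q : M -> M -> M -> Prop) :
  @definable M 3 (fun c : unit * M * M * M =>
    Q (snd (fst (fst c))) (snd (fst c)) (snd c)) ->
  a ∈ B ->
  (forall n y, n ∈ omega -> y ∈ B -> exists y', y' ∈ B /\ Q n y y') ->
  (forall n y y1 y2, n ∈ omega -> y ∈ B -> Q n y y1 -> Q n y y2 -> y1 = y2) ->
  exists f, is_function f omega B /\ app f zero = a /\
    forall n, n ∈ omega -> Q n (app f n) (app f (succ n)).
Proof.
move=> dQ ha tot uni.
pose (closed r := opair zero a ∈ r /\ forall n y y', n ∈ omega -> y' ∈ B ->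
  opair n y ∈ r -> Q n y y' -> opair (succ n) y' ∈ r).
pose r := sep (prod omega B) (fun z => forall r, closed r -> z ∈ r).
have memr z : z ∈ r <-> z ∈ prod omega B /\ forall r, closed r -> z ∈ r.
  by rewrite /r /closed; rewrite_sep.
have r0 : opair zero a ∈ r.
  rewrite memr mem_opair_prod; split; last by move=> ? [].
  by split=> //; apply: omega_zero.
have rS n y y' : n ∈ omega -> y' ∈ B -> opair n y ∈ r -> Q n y y' -> opair (succ n) y' ∈ r.
  move=> hn hy'; rewrite !memr !mem_opair_prod => -[[_ hy] h] q.
  split=> [|r' cr']; first by split=> //; apply: omega_succ.
  by apply: (proj2 cr' n y) => //; apply: h.
(* a pair of [r] that no closure step produces can be removed from [r] *)
have rinv z : z ∈ r -> z = opair zero a \/ exists n y y',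
    n ∈ omega /\ y' ∈ B /\ opair n y ∈ r /\ Q n y y' /\ z = opair (succ n) y'.
  move=> hz; apply: contrapT => nz.
  have /memr[_ /(_ (sep r (fun w => w <> z)))] := hz.
  have mr' w : w ∈ sep r (fun w => w <> z) <-> w ∈ r /\ w <> z by rewrite_sep.
  rewrite mr'; case=> //; split.
    by rewrite mr'; split=> // e; apply: nz; left.
  move=> n y y' hn hy'; rewrite !mr' => -[h1 h2] q; split; first exact: rS q.
  by move=> e; apply: nz; right; exists n, y, y'.
pose F n := exists y, opair n y ∈ r /\ forall y', opair n y' ∈ r -> y' = y.
have Fn n : n ∈ omega -> F n.
  move: n; apply: omega_ind; first by definability.
    exists a; split=> // y' /rinv[/opair_inj[]//|[n [y [y1 [_ [_ [_ [_]]]]]]]].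
    by move/opair_inj => [/zero_not_succ].
  move=> n hn [y [hy uy]].
  have [_ yB] : n ∈ omega /\ y ∈ B by move: hy; rewrite memr mem_opair_prod => -[].
  have [y' [hy' q]] := tot n y hn yB; exists y'; split; first exact: rS q.
  move=> y2 /rinv[/opair_inj[/esym/zero_not_succ]//|].
  move=> [n' [y3 [y4 [hn' [_ [h [q']]]]]]] /opair_inj[/(succ_inj hn hn') e ->].
  by subst n'; apply: uni q' _ => //; rewrite ?(uy _ h) //.
have hr : is_function r omega B.
  split=> [p|x /Fn[y [h1 h2]]].
    by rewrite memr => -[/mem_prod[x [y [? [? ->]]]]] _; exists x, y; rewrite is_pairE.
  by exists y; rewrite /unique relE; split=> // y' /relE /h2.
exists r; split=> //; split.
  by have := rel_function hr zero a; rewrite relE; tauto.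
move=> n hn; have [y' [hy' q]] := tot n _ hn (app_cod hr hn).
have := app_rel hr hn; rewrite relE => h1.
have := rS _ _ _ hn hy' h1 q; rewrite -relE (rel_function hr) => -[_ ->] //.
Qed.

End Omega.
Arguments omega {M}.
Arguments omega_zero {M}.

Ltac definability_functions :=
  lazymatch goal with
  | |- definable (fun _ => rel _ _ _) => refine (definable_rel _ _ _)
  end.
Ltac definability_hook ::=
  first [definability_functions | definability_pairs | definability_sets].

(** * Finite and countable sets *)

Section FiniteCountable.
Variable M : zf_model.
Implicit Types a b e f g h k m n p q r s t u v w x y z : M.

Definition insert u t : M := cup t (upair u u).

Lemma mem_insert u t x : x ∈ insert u t <-> x ∈ t \/ x = u.
Proof. by rewrite mem_cup mem_upair; tauto. Qed.

Lemma finite_zero : finite (zero : M).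
Proof.
exists omega, zero; rewrite is_omegaE; split=> //; split; first exact: omega_zero.
by exists zero; split; [split=> x|move=> y] => /mem_zero.
Qed.

Lemma finite_insert u t : finite t -> finite (insert u t).
Proof.
move=> [w [n []]]; rewrite is_omegaE => -> [hn [f hf]].
have [ut|ut] := pselect (u ∈ t).
  have -> : insert u t = t.
    by apply: ext => z; rewrite mem_insert; split=> [[//|->//]|]; left.
  by exists omega, n; rewrite is_omegaE; split=> //; split=> //; exists f.
exists omega, (succ n); rewrite is_omegaE; split=> //; split; first exact: omega_succ.
have [ff fb] := hf.
pose f' := insert (opair u n) f.
have f'E x y : rel f' x y <-> rel f x y \/ (x = u /\ y = n).
  rewrite !relE /f' mem_insert; split=> [[|/opair_inj]|[|[-> ->]]]; tauto.
exists f'; split; [split=> [p|x]|move=> y].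
- rewrite /f' mem_insert => -[/(proj1 ff)[x [y [? [? ?]]]]|->].
    by exists x, y; rewrite mem_insert mem_succ; tauto.
  by exists u, n; rewrite mem_insert mem_succ is_pairE; tauto.
- rewrite mem_insert => -[hx|->].
    have [y [h1 h2]] := proj2 ff x hx; exists y; split; first by rewrite f'E; left.
    by move=> y'; rewrite f'E => -[/h2//|[e _]]; subst x.
  exists n; split; first by rewrite f'E; right.
  by move=> y; rewrite f'E => -[/(rel_dom ff)[]|[]].
- rewrite mem_succ => -[hy|->].
    have [x [h1 h2]] := fb y hy; exists x; split; first by rewrite f'E; left.
    by move=> x'; rewrite f'E => -[/h2//|[_ e]]; subst y; have /mem_irrefl := hy.
  exists u; split; first by rewrite f'E; right.
  by move=> x; rewrite f'E => -[/(rel_dom ff)[_ /mem_irrefl]|[]].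
Qed.

(** All that is used about finiteness: arguments with finite subcovers, and proofs
    that a set is infinite, go through this induction. *)
Lemma finite_ind (P : M -> Prop) :
  @definable M 1 (fun c : unit * M => P (snd c)) ->
  P zero -> (forall t u, P t -> P (insert u t)) ->
  forall t, finite t -> P t.
Proof.
move=> dP P0 PS t [w [n []]]; rewrite is_omegaE => -> [hn [f hf]].
move: n hn t f hf; apply: omega_ind; first by definability.
  move=> t f [[ff1 ff2] _]; suff -> : t = zero by [].
  apply: ext => x; split=> [/ff2[y []]|/mem_zero] //.
  by rewrite relE => /ff1 [? [? [_ [/mem_zero]]]].
move=> n hn IH t f [ff fb].
have hn1 : n ∈ succ n by rewrite mem_succ; right.
have [u [hu uu]] := fb n hn1; have [ut _] := rel_dom ff hu.
pose t' := sep t (fun x => x <> u).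
have t'E x : x ∈ t' <-> x ∈ t /\ x <> u by rewrite /t'; rewrite_sep.
have -> : t = insert u t'.
  apply: ext => x; rewrite mem_insert t'E; split=> [h|[[]//|->//]].
  by have [->|?] := pselect (x = u); [right|left].
apply: PS.
pose f' := sep f (fun p => p <> opair u n).
have f'E x y : rel f' x y <-> rel f x y /\ x <> u.
  rewrite !relE /f'; rewrite_sep; split=> -[h1 h2]; split=> // e.
    apply: h2; rewrite e; congr opair; subst x.
    have [z [_ uz]] := proj2 ff _ ut.
    by apply: etrans (esym (uz y _)) (uz n hu); rewrite relE.
  by have [] := opair_inj e.
have hf'dom x y : rel f' x y -> x ∈ t' /\ y ∈ n.
  rewrite f'E t'E => -[h1 h2]; have [h3] := rel_dom ff h1.
  by rewrite mem_succ => -[//|e]; subst y; case: h2; rewrite (uu _ h1).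
apply: (IH _ f'); split; [split=> [p hp|x]|move=> y hy].
- have : p ∈ f by move: hp; rewrite /f'; rewrite_sep => -[].
  move=> /(proj1 ff)[x [y [_ [_ e]]]]; exists x, y; move: (e); rewrite is_pairE => e'.
  by subst p; have [] := hf'dom x y; rewrite ?relE.
- rewrite t'E => -[hx xu]; have [y [h1 h2]] := proj2 ff x hx; exists y.
  by split; [rewrite f'E|move=> y'; rewrite f'E => -[/h2]].
- have [x [h1 h2]] := fb y (proj2 (mem_succ n y) (or_introl hy)); exists x.
  split; last by move=> x'; rewrite f'E => -[/h2].
  rewrite f'E; split=> // e; subst x; have e := rel_function ff u.
  by have [_ h3] := proj1 (e y) h1; have [_ h4] := proj1 (e n) hu;
    move: hy; rewrite -h3 h4 => /mem_irrefl.
Qed.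

Lemma countableE a : countable a <-> exists f, is_function f a omega /\
  forall x x', x ∈ a -> x' ∈ a -> app f x = app f x' -> x = x'.
Proof.
split=> [[w [s []]]|[f [hf inj]]].
  rewrite is_omegaE => -> [sw [f [hf bf]]]; exists f; split.
    split=> [p /(proj1 hf)[x [y [? [/sw ? ?]]]]|]; [by exists x, y|exact: (proj2 hf)].
  move=> x x' hx hx' e; have [z [_ uz]] := bf _ (app_cod hf hx).
  apply: etrans (esym (uz x _)) (uz x' _); first exact: app_rel hf _ hx.
  by rewrite e; apply: app_rel hf _ hx'.
pose s := sep omega (fun n => exists x, rel f x n).
have sE n : n ∈ s <-> n ∈ omega /\ exists x, rel f x n by rewrite /s; rewrite_sep.
exists omega, s; rewrite is_omegaE; split=> //; split; first by move=> n /sE[].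
exists f; split; [split; last exact: (proj2 hf)|].
  move=> p hp; have [x [y [? [? e]]]] := proj1 hf p hp.
  exists x, y; rewrite sE; split=> //; split=> //; split=> //; exists x.
  by move: e hp; rewrite is_pairE relE => ->.
move=> n /sE[_ [x h]]; exists x; split=> // x' h'; apply: inj.
- by have [] := rel_dom hf h.
- by have [] := rel_dom hf h'.
- by move: h h'; rewrite !(rel_function hf) => -[_ ->] [_ ->].
Qed.

(** The least index of each element is an injection into [omega], so names need
    not be unique or chosen. *)
Lemma countable_of_relation a (Q : M -> M -> Prop) :
  @definable M 2 (fun c : unit * M * M => Q (snd (fst c)) (snd c)) ->
  (forall x, x ∈ a -> exists n, n ∈ omega /\ Q x n) ->
  (forall x x' n, x ∈ a -> x' ∈ a -> n ∈ omega -> Q x n -> Q x' n -> x = x') ->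
  countable a.
Proof.
move=> dQ tot inj.
have [|||f [hf fQ]] := @function_of_relation M a omega
  (fun x n => Q x n /\ forall k, k ∈ n -> ~ Q x k); first by definability.
- move=> x hx; have [n [hn q]] := tot x hx.
  by have [|||m [hm [q1 q2]]] := @omega_least M (Q x) n; [definability|..|exists m].
- move=> x m n _ hm hn [q1 q2] [q3 q4].
  by have [/q4|[|/q2]] := nat_total hm hn.
rewrite countableE; exists f; split=> // x x' hx hx' e.
apply: (inj _ _ (app f x)) => //; first exact: (app_cod hf hx).
  by have [] := fQ _ hx.
by rewrite e; have [] := fQ _ hx'.
Qed.

End FiniteCountable.

(** * Topological spaces with an enumerated base *)

Section Topology.
Variable M : zf_model.
Implicit Types a b c e f g h k m n p q r s t u v w x y z : M.

Definition cap a b : M := sep a (fun x => x ∈ b).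
Definition diff a b : M := sep a (fun x => x ∉ b).

Lemma mem_cap a b x : x ∈ cap a b <-> x ∈ a /\ x ∈ b.
Proof. by rewrite /cap; rewrite_sep. Qed.

Lemma mem_diff a b x : x ∈ diff a b <-> x ∈ a /\ x ∉ b.
Proof. by rewrite /diff; rewrite_sep. Qed.

Lemma is_interE c a b : is_inter c a b <-> c = cap a b.
Proof.
split=> [h|->] => [|x]; last by rewrite mem_cap.
by apply: ext => x; rewrite mem_cap; apply: h.
Qed.

Lemma is_diffE c a b : is_diff c a b <-> c = diff a b.
Proof.
split=> [h|->] => [|x]; last by rewrite mem_diff.
by apply: ext => x; rewrite mem_diff; apply: h.
Qed.

Lemma is_unionE u s : is_union u s <-> u = union s.
Proof.
split=> [h|->] => [|x]; last by rewrite mem_union.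
by apply: ext => x; rewrite mem_union; apply: h.
Qed.

Section Space.
Variable X : space M.
Hypothesis hX : is_topology X.

(** The union of all open subsets of [a] is taken, so no neighbourhoods are
    chosen. *)
Lemma locally_open a : a ⊆ points X ->
  (forall x, x ∈ a -> exists u, u ∈ opens X /\ x ∈ u /\ u ⊆ a) -> a ∈ opens X.
Proof.
move=> sa loc; pose s := sep (opens X) (fun u => u ⊆ a).
have sE u : u ∈ s <-> u ∈ opens X /\ u ⊆ a by rewrite /s; rewrite_sep.
apply: (open_union hX (s := s)); first by move=> u /sE[].
move=> x; split=> [/loc[u [? [? ?]]]|[u [/sE[_ h] /h]]] //.
by exists u; rewrite sE.
Qed.

Lemma open_cap u v : u ∈ opens X -> v ∈ opens X -> cap u v ∈ opens X.
Proof. by move=> hu hv; apply: (open_inter hX hu hv); rewrite is_interE. Qed.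

Lemma open_zero : zero ∈ opens X.
Proof. by apply: (open_empty hX); rewrite is_emptyE. Qed.

Lemma closed_setE c : closed_set X c <-> c ⊆ points X /\
  forall x, x ∈ points X -> x ∉ c -> exists u, u ∈ opens X /\ x ∈ u /\
    forall z, z ∈ u -> z ∉ c.
Proof.
split=> [[sc [u [hu]]]|[sc h]].
  rewrite is_diffE => eu; split=> // x hx xc; exists u.
  have uE z : z ∈ u <-> z ∈ points X /\ z ∉ c by rewrite eu mem_diff.
  by rewrite uE; split=> //; split=> // z /uE[].
split=> //; exists (diff (points X) c); rewrite is_diffE; split=> //.
apply: locally_open => [x|x]; rewrite mem_diff; first by case.
move=> [hx /(h x hx)[u [hu [xu du]]]]; exists u; split=> //; split=> // z hz.
by rewrite mem_diff; split; [exact: (open_subset hX _ hu _ hz)|exact: du].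
Qed.

Lemma in_closureE a x : a ⊆ points X -> in_closure X a x <-> x ∈ points X /\
  forall u, u ∈ opens X -> x ∈ u -> exists z, z ∈ u /\ z ∈ a.
Proof.
move=> sa; split=> -[hx h]; split=> //.
  move=> u hu xu.
  apply: contrapT => no; have : x ∈ diff (points X) u.
    apply: h; last first.
      move=> z hz; rewrite mem_diff; split; first exact: sa.
      by move=> zu; apply: no; exists z.
    rewrite closed_setE; split=> [z|y hy]; rewrite mem_diff; first by case.
    move=> h; have yu : y ∈ u by apply: contrapT => ?; apply: h.
    by exists u; split=> //; split=> // z zu; rewrite mem_diff => -[].
  by rewrite mem_diff => -[].
move=> c; rewrite closed_setE => -[sc hc] ac; apply: contrapT => /(hc x hx)[u [hu [xu du]]].
by have [z [zu /ac]] := h u hu xu; apply: du.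
Qed.

(** An enumeration by all of [omega]; unused indices can be sent to the empty open
    set. *)
Definition enumerates_base e : Prop := is_function e omega (opens X) /\
  forall u x, u ∈ opens X -> x ∈ u ->
    exists k, k ∈ omega /\ x ∈ app e k /\ app e k ⊆ u.

Lemma second_countable_enumerates :
  second_countable X <-> exists e, enumerates_base e.
Proof.
split=> [[b [[sb hb]]]|[e [he hb]]].
  rewrite countableE => -[f [hf inj]].
  have [|||e [he eQ]] := @function_of_relation M omega (opens X)
    (fun k u => u ∈ b /\ app f u = k \/
       u = zero /\ ~ exists v, v ∈ b /\ app f v = k); first by definability.
  - move=> k hk; have [[u [ub fu]]|no] := pselect (exists v, v ∈ b /\ app f v = k).
      by exists u; split; [exact: sb|left].
    by exists zero; split; [exact: open_zero|right].
  - move=> k u v _ _ _ [[ub fu]|[-> no]] [[vb fv]|[-> no']] //.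
    + by apply: inj => //; rewrite fv.
    + by case: no'; exists u.
    + by case: no; exists v.
  exists e; split=> // u x hu xu; have [v [vb [xv vu]]] := hb u x hu xu.
  have hk := app_cod hf vb; exists (app f v); split=> //.
  case: (eQ _ hk) => [[h1 h2]|[_ []]]; last by exists v.
  by rewrite (inj _ _ h1 vb h2).
pose b := sep (opens X) (fun u => exists k, k ∈ omega /\ app e k = u).
have bE u : u ∈ b <-> u ∈ opens X /\ exists k, k ∈ omega /\ app e k = u.
  by rewrite /b; rewrite_sep.
exists b; split; last first.
  apply: (@countable_of_relation M b (fun u k => app e k = u)); first by definability.
    by move=> u /bE[].
  by move=> u v k _ _ _ -> ->.
split=> [u /bE[]//|u x hu xu]; have [k [hk [h1 h2]]] := hb u x hu xu.
exists (app e k); rewrite bE; split=> //; split; last by exists k.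
exact: (app_cod he).
Qed.

(** The intersection of the basic sets with index below [n] that contain [x],
    a decreasing neighbourhood base defined without recursion. *)
Definition nbhd e x n : M :=
  sep (points X) (fun y => forall k, k ∈ n -> x ∈ app e k -> y ∈ app e k).

Lemma mem_nbhd e x n y : y ∈ nbhd e x n <->
  y ∈ points X /\ forall k, k ∈ n -> x ∈ app e k -> y ∈ app e k.
Proof. by rewrite /nbhd; rewrite_sep. Qed.

Section Enumerated.
Variable e : M.
Hypothesis he : enumerates_base e.

Lemma mem_nbhd_self x n : x ∈ points X -> x ∈ nbhd e x n.
Proof. by rewrite mem_nbhd. Qed.

Lemma nbhd_open x n : n ∈ omega -> nbhd e x n ∈ opens X.
Proof.
move: n; apply: omega_ind; first by definability.
  have -> : nbhd e x zero = points X; last exact: open_points.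
  by apply: ext => y; rewrite mem_nbhd; split=> [[]//|h]; split=> // k /mem_zero.
move=> n hn IH; have [xn|xn] := pselect (x ∈ app e n).
  have -> : nbhd e x (succ n) = cap (nbhd e x n) (app e n).
    apply: ext => y; rewrite mem_cap !mem_nbhd; split=> [[hy h]|[[hy h] yn]].
      split; first by split=> // k kn; apply: h; rewrite mem_succ; left.
      by apply: h => //; rewrite mem_succ; right.
    by split=> // k; rewrite mem_succ => -[/h|->].
  by apply: open_cap => //; apply: (app_cod (proj1 he)).
have -> // : nbhd e x (succ n) = nbhd e x n.
apply: ext => y; rewrite !mem_nbhd; split=> -[hy h]; split=> // k.
  by move=> kn; apply: h; rewrite mem_succ; left.
by rewrite mem_succ => -[/h//|->].
Qed.

Lemma nbhd_antitone x m n : m ⊆ n -> nbhd e x n ⊆ nbhd e x m.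
Proof. by move=> mn y; rewrite !mem_nbhd => -[hy h]; split=> // k /mn; apply: h. Qed.

Lemma nbhd_basis u x : u ∈ opens X -> x ∈ u -> exists n, n ∈ omega /\
  forall m, m ∈ omega -> n ⊆ m -> nbhd e x m ⊆ u.
Proof.
move=> hu xu; have [k [hk [xk ku]]] := proj2 he u x hu xu.
exists (succ k); split=> [|m hm km y]; first exact: omega_succ.
by rewrite mem_nbhd => -[_ /(_ k)] h; apply/ku/h => //; apply: km; rewrite mem_succ; right.
Qed.

Lemma converges_of_nbhd s x : (forall n y, n ∈ omega -> rel s n y -> y ∈ nbhd e x n) ->
  converges_to X omega s x.
Proof.
move=> h u hu xu; have [n [hn hN]] := nbhd_basis hu xu; exists n; split=> // m y hm nm hy.
by apply: (hN m) => //; apply: h.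
Qed.
End Enumerated.
End Space.
End Topology.

(** * Selection in compact spaces *)

Section Compact.
Variable M : zf_model.
Implicit Types a b c e f g h k m n p q r s t u v w x y z : M.
Variable X : space M.
Hypothesis hX : is_topology X.
Hypothesis haus : hausdorff X.

(** [z] is in the closure of [u], for [z] in the space. *)
Definition adherent u z : Prop := forall v, v ∈ opens X -> z ∈ v ->
  exists w, w ∈ v /\ w ∈ u.

(** A compact set satisfies the regularity axiom, even at points outside it:
    cover it by open sets that lie in [o] or can be separated from [y], and
    intersect the finitely many neighbourhoods of [y] that occur.  With [o]
    empty this says that compact sets are closed. *)
Lemma compact_regular k o y : compact_set X k -> o ∈ opens X ->
  y ∈ points X -> (y ∈ k -> y ∈ o) ->
  exists v, v ∈ opens X /\ y ∈ v /\ forall z, z ∈ k -> adherent v z -> z ∈ o.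
Proof.
move=> [sk ck] ho hy yo.
pose good u := u ⊆ o \/ exists v, v ∈ opens X /\ y ∈ v /\ forall z, z ∈ u -> z ∉ v.
pose s := sep (opens X) good.
have sE u : u ∈ s <-> u ∈ opens X /\ good u by rewrite /s /good; rewrite_sep.
have [|x xk|t [ts [ft ct]]] := ck s; first by move=> u /sE[].
  have [xo|xo] := pselect (x ∈ o); first by exists o; rewrite sE; split=> //; split=> //; left.
  have xy : x <> y by move=> e; subst x; apply: xo; apply: yo.
  have [u [v [hu [hv [xu [yv d]]]]]] := haus (sk _ xk) hy xy.
  by exists u; rewrite sE; split=> //; split=> //; right; exists v.
have : t ⊆ s -> exists v, v ∈ opens X /\ y ∈ v /\
    forall u, u ∈ t -> u ⊆ o \/ forall z, z ∈ u -> z ∉ v.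
  move: t ft {ts ct}; apply: finite_ind; first by definability.
    by exists (points X); split; [exact: open_points|split=> // u /mem_zero].
  move=> t u IH ts; have [|v [hv [yv h]]] := IH.
    by move=> w wt; apply: ts; rewrite mem_insert; left.
  have /sE[hu [uo|[v' [hv' [yv' d]]]]] : u ∈ s by apply: ts; rewrite mem_insert; right.
    by exists v; split=> //; split=> // w; rewrite mem_insert => -[/h|->] //; left.
  exists (cap v v'); split; first exact: open_cap.
  split=> [|w]; rewrite ?mem_cap // mem_insert => -[/h[?|h']|->]; first by left.
    by right=> z /h' zv; rewrite mem_cap => -[].
  by right=> z /d zv; rewrite mem_cap => -[].
move=> /(_ ts)[v [hv [yv h]]]; exists v; split=> //; split=> // z zk az.
have [u [ut zu]] := ct z zk; have [/(_ z zu)//|d] := h u ut.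
by have /ts/sE[hu _] := ut; have [w [/d]] := az u hu zu.
Qed.

Lemma compact_closed k : compact_set X k -> closed_set X k.
Proof.
move=> ck; rewrite closed_setE //; split=> [|x hx xk]; first exact: (proj1 ck).
have [//|v [hv [xv h]]] := compact_regular ck (open_zero hX) hx.
exists v; split=> //; split=> // z zv zk; apply: (@mem_zero _ z).
by apply: h => // u hu zu; exists z.
Qed.

Lemma closed_complement c : closed_set X c -> diff (points X) c ∈ opens X.
Proof. by move=> [_ [u [hu]]]; rewrite is_diffE => <-. Qed.

(** Otherwise the complements cover [k]; any finitely many of them are contained in
    a single one. *)
Lemma compact_sequence k f : compact_set X k -> is_function f omega (pow k) ->
  (forall n, n ∈ omega -> closed_set X (app f n) /\ nonempty (app f n)) ->
  (forall n, n ∈ omega -> app f (succ n) ⊆ app f n) ->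
  exists z, forall n, n ∈ omega -> z ∈ app f n.
Proof.
move=> [sk ck] hf hcl dec.
have anti n m : n ∈ omega -> m ∈ n -> app f n ⊆ app f m.
  move=> hn; move: n hn m; apply: omega_ind; first by definability.
    by move=> m /mem_zero.
  move=> n hn IH m; rewrite mem_succ => -[mn z /(dec n hn)|->]; last exact: dec.
  exact: IH.
apply: contrapT => no.
pose s := sep (opens X) (fun u => exists n, n ∈ omega /\ forall z, z ∈ u -> z ∉ app f n).
have sE u : u ∈ s <-> u ∈ opens X /\
    exists n, n ∈ omega /\ forall z, z ∈ u -> z ∉ app f n by rewrite /s; rewrite_sep.
have [|x xk|t [ts [ft ct]]] := ck s; first by move=> u /sE[].
  have [n [hn xn]] : exists n, n ∈ omega /\ x ∉ app f n.
    apply: contrapT => no'; apply: no; exists x => n hn.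
    by apply: contrapT => ?; apply: no'; exists n.
  exists (diff (points X) (app f n)); rewrite sE !mem_diff; split; last by split=> //; apply: sk.
  split; first by apply: closed_complement; case: (hcl n hn).
  by exists n; split=> // z; rewrite mem_diff => -[].
have : t ⊆ s -> exists n, n ∈ omega /\
    forall u, u ∈ t -> forall z, z ∈ u -> z ∉ app f n.
  move: t ft {ts ct}; apply: finite_ind; first by definability.
    by exists zero; split; [exact: omega_zero|move=> u /mem_zero].
  move=> t u IH ts; have [|n [hn h]] := IH.
    by move=> w wt; apply: ts; rewrite mem_insert; left.
  have /sE[hu [m [hm d]]] : u ∈ s by apply: ts; rewrite mem_insert; right.
  have [mn|nm] : app f n ⊆ app f m \/ app f m ⊆ app f n.
    have [h1|[->|h1]] := nat_total hm hn; [left|left|right] => //; exact: anti.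
    exists n; split=> // w; rewrite mem_insert => -[/h//|-> z zu zn].
    by apply: (d z zu); apply: mn.
  exists m; split=> // w; rewrite mem_insert => -[wt z zw zm|->//].
  by apply: (h w wt z zw); apply: nm.
move=> /(_ ts)[n [hn h]]; have [_ [z zn]] := hcl n hn.
have zk : z ∈ k by have := app_cod hf hn; rewrite mem_pow; apply.
by have [u [ut zu]] := ct z zk; apply: (h u ut z zu).
Qed.

Section Selection.
Variable e : M.
Hypothesis he : enumerates_base X e.

(** A point is coded by the indices [j] of the basic sets to which it is
    adherent; [lex_maximum c z] says that the code of [z] is lexicographically
    largest among those of the points of [c].  This selects a point without any
    choice. *)
Definition lex_maximum c z : Prop := z ∈ c /\ forall w, w ∈ c -> w <> z ->
  exists j, j ∈ omega /\ adherent (app e j) z /\ ~ adherent (app e j) w /\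
    forall i, i ∈ j -> adherent (app e i) z <-> adherent (app e i) w.

Lemma lex_maximum_unique c z z' : lex_maximum c z -> lex_maximum c z' -> z = z'.
Proof.
move=> [zc hz] [zc' hz']; apply: contrapT => ne.
have [|j [hj [h1 [h2 h3]]]] := hz _ zc'; first by move=> E; apply: ne.
have [//|j' [hj' [h1' [h2' h3']]]] := hz' _ zc.
by have [/h3'|[E|/h3]] := nat_total hj hj'; [|subst j'|]; tauto.
Qed.

(** The sets [f n] keep the points of [c] whose codes are largest as far as the
    first [n] places: at each place the points with a larger digit are retained
    if there are any.  A point common to all [f n] is the maximum, because codes
    separate points. *)
Lemma lex_maximum_exists k c : compact_set X k -> closed_set X c -> c ⊆ k ->
  nonempty c -> exists z, lex_maximum c z.
Proof.
move=> ck cc sck nc.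
pose Q (n y y' : M) := y' = sep y (fun z =>
  (exists w, w ∈ y /\ adherent (app e n) w) -> adherent (app e n) z).
have dQ : @definable M 3 (fun c : unit * M * M * M =>
    Q (snd (fst (fst c))) (snd (fst c)) (snd c)).
  by definability.
have [|n y hn yk|n y y1 y2 _ _ -> ->|f [hf [f0 fS]]] := @recursion M (pow k) c Q dQ.
- by rewrite mem_pow.
- eexists; split; last by reflexivity.
  rewrite mem_pow => z; rewrite mem_sep; first by case=> zy _; move: yk; rewrite mem_pow; apply.
  by definability.
- by [].
have memS n z : n ∈ omega -> z ∈ app f (succ n) <-> z ∈ app f n /\
    ((exists w, w ∈ app f n /\ adherent (app e n) w) -> adherent (app e n) z).
  by move=> /fS ->; rewrite mem_sep //; definability.
have [||z hz] := compact_sequence ck hf.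
- move: f0 {dQ fS}; move: c cc sck nc => c cc _ nc f0.
  apply: omega_ind; first by definability.
    by rewrite f0.
  move=> n hn [cl [x xn]]; split; last first.
    have [[w [wn aw]]|no] := pselect (exists w, w ∈ app f n /\ adherent (app e n) w).
      by exists w; rewrite memS.
    by exists x; rewrite memS.
  rewrite closed_setE //; split=> [y|y hy].
    by rewrite memS // => -[yn _]; move: (proj1 cl); apply.
  have [yn|yn] := pselect (y ∈ app f n); last first.
    move=> _; have [_ /(_ y hy yn)[u [hu [yu d]]]] := proj1 (closed_setE hX _) cl.
    by exists u; split=> //; split=> // z /d zn; rewrite memS // => -[].
  rewrite memS // => h.
  have ay : ~ adherent (app e n) y by move=> ay; apply: h.
  have ex : exists w, w ∈ app f n /\ adherent (app e n) w by apply: contrapT => no; apply: h.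
  have [u [hu [yu d]]] : exists u, u ∈ opens X /\ y ∈ u /\ forall w, w ∈ u -> w ∉ app e n.
    apply: contrapT => no; apply: ay => u hu yu; apply: contrapT => no'; apply: no.
    by exists u; split=> //; split=> // w wu wn; apply: no'; exists w.
  exists u; split=> //; split=> // z zu; rewrite memS // => -[_ /(_ ex) az].
  by have [w [wu wn]] := az u hu zu; apply: (d w).
- by move=> n hn x; rewrite memS // => -[].
exists z; split; first by rewrite -f0; apply: hz; exact: omega_zero.
move=> w wc wz.
pose differ j := ~ (adherent (app e j) z <-> adherent (app e j) w).
have inX x : x ∈ c -> x ∈ points X by apply: (proj1 cc).
have zc : z ∈ c by rewrite -f0; apply: hz; exact: omega_zero.
have [m [hm dm]] : exists m, m ∈ omega /\ differ m.
  have [|u [v [hu [hv [zu [wv d]]]]]] := haus (inX _ zc) (inX _ wc).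
    by move=> E; apply: wz.
  have [m [hm [zm mu]]] := proj2 he u z hu zu; exists m; split=> // -[h _].
  have [|x [xv xm]] := h _ v hv wv; first by move=> u' _ zu'; exists z.
  by apply: (d x) => //; apply: mu.
have [|||j [hj [dj lj]]] := @omega_least M differ m; [|exact: hm|exact: dm|].
  by definability.
have agree i : i ∈ j -> adherent (app e i) z <-> adherent (app e i) w.
  by move=> /lj ?; apply: contrapT.
(* no stage up to [j] can have removed [w] without removing [z] *)
have wf i : i ∈ omega -> i ∈ succ j -> w ∈ app f i.
  move: i; apply: omega_ind; [by definability|by rewrite f0|move=> i hi IH ij].
  have ij' : i ∈ j.
    by move: ij; rewrite mem_succ => -[h|<-]; [apply: nat_trans hj h _|]; rewrite mem_succ; right.
  rewrite memS //; split; first by apply: IH; rewrite mem_succ; left.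
  by have := hz _ (omega_succ hi); rewrite memS // => -[_ h] /h; apply: (proj1 (agree _ ij')).
have wj : w ∈ app f j by apply: wf => //; rewrite mem_succ; right.
have := hz _ (omega_succ hj); rewrite memS // => -[_ h].
exists j; split=> //.
have nw : ~ adherent (app e j) w.
  by move=> aw; apply: dj; split=> // _; apply: h; exists w.
split; last by [].
by apply: contrapT => az; apply: dj; split.
Qed.
End Selection.

(** The set [a] is not closed, so some compact [k] meets it in a set that is not
    closed, and [x] is an accumulation point of [k].  The sets [D j] of the points
    of [k] adherent to the [j]-th basic set are closed, and by regularity of [k]
    each neighbourhood of [x] contains a nonempty one that avoids [x].  The
    sequence consists of the points selected from the first such [D j]. *)
Lemma k_space_sequence e a x : enumerates_base X e -> k_space X ->
  (forall y, y ∈ points X <-> y ∈ a \/ y = x) -> x ∉ a -> in_closure X a x ->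
  exists s, is_function s omega a /\ converges_to X omega s x.
Proof.
move=> he [_ kX] pX xa.
have aX : a ⊆ points X by move=> y ya; rewrite pX; left.
rewrite in_closureE // => -[hx clx].
have [k [ck ncl]] : exists k, compact_set X k /\ ~ closed_set X (cap a k).
  apply: contrapT => no; have : closed_set X a.
    apply: kX => // k i ck; rewrite is_interE => ->.
    by apply: contrapT => ?; apply: no; exists k.
  rewrite closed_setE // => -[_ /(_ x hx xa)[u [hu [xu d]]]].
  by have [z [/d]] := clx u hu xu.
have [sk clk] := (proj1 ck, compact_closed ck).
have acc u : u ∈ opens X -> x ∈ u -> exists y, y ∈ u /\ y ∈ k /\ y <> x.
  move=> hu xu; apply: contrapT => no; apply: ncl.
  rewrite closed_setE //; split=> [y|y hy]; first by rewrite mem_cap => -[/aX].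
  rewrite mem_cap => yak; have [yk|yk] := pselect (y ∈ k).
    have -> : y = x by have /pX[ya|//] := hy; case: yak.
    exists u; split=> //; split=> // z zu; rewrite mem_cap => -[za zk].
    by apply: no; exists z; split=> //; split=> // E; apply: xa; rewrite -E.
  have [_ /(_ y hy yk)[v [hv [yv d]]]] := proj1 (closed_setE hX _) clk.
  by exists v; split=> //; split=> // z /d zk; rewrite mem_cap => -[].
pose D j := sep k (adherent (app e j)).
have memD j z : z ∈ D j <-> z ∈ k /\ adherent (app e j) z.
  by rewrite /D; rewrite_sep.
have closedD j : closed_set X (D j).
  rewrite closed_setE //; split=> [y /memD[/sk//]|y hy].
  have [_ h] := proj1 (closed_setE hX _) clk.
  have [yk|yk] := pselect (y ∈ k); last first.
    move=> _; have [u [hu [yu d]]] := h y hy yk.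
    by exists u; split=> //; split=> // z /d zk /memD[].
  rewrite memD => nD; apply: contrapT => no; apply: nD; split=> // u hu yu.
  apply: contrapT => no'; apply: no; exists u; split=> //; split=> // z zu /memD[_ az].
  by have [w [wu wj]] := az u hu zu; apply: no'; exists w.
pose good n j := nonempty (D j) /\ forall z, z ∈ D j -> z ∈ nbhd X e x n /\ z <> x.
have goodex n : n ∈ omega -> exists j, j ∈ omega /\ good n j.
  move=> hn; have hN := nbhd_open hX he x hn.
  have [y [yN [yk yx]]] := acc _ hN (mem_nbhd_self e n hx).
  have hy := sk _ yk.
  have [u [v [hu [hv [yu [xv d]]]]]] := haus hy hx yx.
  have hNu := open_cap hX hN hu.
  have [|o [ho [yo h]]] := compact_regular ck hNu hy; first by rewrite mem_cap.
  have [j [hj [yj jo]]] := proj2 he o y ho yo; exists j; split=> //; split.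
    by exists y; rewrite memD; split=> // w _ yw; exists y.
  move=> z /memD[zk az]; have /mem_cap[zN zu] : z ∈ cap (nbhd X e x n) u.
    apply: h => // w hw zw; have [p [pw pj]] := az w hw zw.
    by exists p; split=> //; apply: jo.
  by split=> // E; subst z; apply: (d x).
have [|||s [hs sQ]] := @function_of_relation M omega a (fun n y => exists j,
    j ∈ omega /\ good n j /\ (forall i, i ∈ j -> ~ good n i) /\ lex_maximum e (D j) y).
- by definability.
- move=> n hn; have [j0 [hj0 g0]] := goodex n hn.
  have [|||j [hj [gj lj]]] := @omega_least M (good n) j0; [|exact: hj0|exact: g0|].
    by definability.
  have [z hz] : exists z, lex_maximum e (D j) z.
    by apply: (lex_maximum_exists he ck) => //; [move=> y /memD[]|exact: (proj1 gj)].
  exists z; split; last by exists j.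
  have [zk _] := proj1 (memD _ _) (proj1 hz).
  by have /pX[//|E] := sk _ zk; have [_ []] := proj2 gj _ (proj1 hz).
- move=> n y y' _ _ _ [j [hj [gj [lj ly]]]] [j' [hj' [gj' [lj' ly']]]].
  have E : j = j' by have [/lj'|[|/lj]] := nat_total hj hj'.
  by subst j'; apply: lex_maximum_unique ly ly'.
exists s; split=> //; apply: (converges_of_nbhd he) => n y hn.
rewrite (rel_function hs) => -[_ <-]; have [j [_ [gj [_ [yD _]]]]] := sQ n hn.
by have [] := proj2 gj _ yD.
Qed.

End Compact.

(** * Convergent sequences and subspaces *)

Section Sequences.
Variable M : zf_model.
Implicit Types a b c e f g h k m n p q r s t u v w x y z : M.
Implicit Types X Y : space M.

Definition with_limit X s x : M := sep (points X)
  (fun y => y = x \/ exists n, n ∈ omega /\ app s n = y).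

Lemma mem_with_limit X s a x y : is_function s omega a -> a ⊆ points X ->
  x ∈ points X -> y ∈ with_limit X s x <-> y = x \/ exists n, n ∈ omega /\ app s n = y.
Proof.
move=> hs sa hx; rewrite /with_limit; rewrite_sep; split=> [[]//|h]; split=> //.
by case: h => [->|[n [hn <-]]] //; apply: sa; apply: (app_cod hs hn).
Qed.

(** A member of the cover that contains [x] contains all but finitely many terms;
    the remaining ones are covered by induction on their number. *)
Lemma with_limit_compact X s a x : is_topology X -> is_function s omega a ->
  a ⊆ points X -> x ∈ points X -> converges_to X omega s x ->
  compact_set X (with_limit X s x).
Proof.
move=> hX hs sa hx cv; have mK y := mem_with_limit y hs sa hx.
split=> [y|c hc cov]; first by rewrite /with_limit; rewrite_sep => -[].
have /mK/cov : x = x \/ exists n, n ∈ omega /\ app s n = x by left.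
move=> [u [uc xu]]; have [n [hn hN]] := cv u (hc _ uc) xu.
have [t [tc [ft ht]]] : exists t, t ⊆ c /\ finite t /\
    forall m, m ∈ n -> exists v, v ∈ t /\ app s m ∈ v.
  move: n hn {hN}; apply: omega_ind; first by definability.
    exists zero; split=> [z /mem_zero//|]; split=> [|z /mem_zero//].
    exact: finite_zero.
  move=> n hn [t [tc [ft ht]]].
  have /mK/cov[v [vc nv]] : app s n = x \/ exists m, m ∈ omega /\ app s m = app s n.
    by right; exists n.
  exists (insert v t); split=> [w|]; first by rewrite mem_insert => -[/tc|->].
  split=> [|m]; first exact: finite_insert.
  rewrite mem_succ => -[/ht[w [wt mw]]|->]; first by exists w; rewrite mem_insert; split=> //; left.
  by exists v; rewrite mem_insert; split=> //; right.
exists (insert u t); split=> [w|]; first by rewrite mem_insert => -[/tc|->].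
split=> [|y]; first exact: finite_insert.
rewrite mK => -[->|[m [hm <-]]]; first by exists u; rewrite mem_insert; split=> //; right.
have [/ht[w [wt mw]]|nm] := pselect (m ∈ n).
  by exists w; rewrite mem_insert; split=> //; left.
exists u; rewrite mem_insert; split; first by right.
apply: (hN m) => //; last exact: (app_rel hs hm).
by rewrite nat_subset // -nat_not_mem.
Qed.

End Sequences.

Section Subspaces.
Variable M : zf_model.
Implicit Types a b c e f g h k m n p q r s t u v w x y z : M.
Variable X : space M.
Hypothesis hX : is_topology X.

Definition subspace a : space M :=
  @Space M a (sep (pow a) (fun v => exists u, u ∈ opens X /\ v = cap u a)).

Lemma subspace_is_subspace a : a ⊆ points X -> is_subspace (subspace a) X.
Proof.
move=> sa; split=> //= v; rewrite_sep; rewrite mem_pow.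
split=> [[_ [u [hu ->]]]|[u [hu]]]; first by exists u; rewrite is_interE.
by rewrite is_interE => ->; split=> [z|]; [rewrite mem_cap => -[]|exists u].
Qed.

Section Given.
Variable Y : space M.
Hypothesis YX : is_subspace Y X.

Lemma mem_opens_subspace v :
  v ∈ opens Y <-> exists u, u ∈ opens X /\ v = cap u (points Y).
Proof. by rewrite (proj2 YX); split=> -[u []]; rewrite ?is_interE => ? ?; exists u; rewrite ?is_interE. Qed.

Lemma open_trace u : u ∈ opens X -> cap u (points Y) ∈ opens Y.
Proof. by move=> hu; rewrite mem_opens_subspace; exists u. Qed.

Lemma subspace_topology : is_topology Y.
Proof.
split=> [v|v||u v i|s u hs].
- by rewrite mem_opens_subspace => -[u [_ ->]] z; rewrite mem_cap => -[].
- rewrite is_emptyE mem_opens_subspace => ->; exists zero; split; first exact: open_zero.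
  by apply: ext => z; rewrite mem_cap; split=> [/mem_zero|[/mem_zero]].
- rewrite mem_opens_subspace; exists (points X); split; first exact: open_points.
  by apply: ext => z; rewrite mem_cap; split=> [h|[]//]; split=> //; apply: (proj1 YX).
- rewrite !mem_opens_subspace is_interE => -[u' [hu ->]] [v' [hv ->]] ->.
  exists (cap u' v'); split; first exact: open_cap.
  by apply: ext => z; rewrite !mem_cap; tauto.
- rewrite is_unionE mem_opens_subspace => ->.
  pose S := sep (opens X) (fun w => cap w (points Y) ∈ s).
  have SE w : w ∈ S <-> w ∈ opens X /\ cap w (points Y) ∈ s by rewrite /S; rewrite_sep.
  exists (union S); split; first by apply: (open_union hX (s := S)); [move=> w /SE[]|rewrite is_unionE].
  apply: ext => z; rewrite mem_cap !mem_union; split.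
    move=> [v [vs zv]]; have /hs/mem_opens_subspace[w [hw ev]] := vs.
    by move: vs zv; rewrite ev mem_cap => vs [zw zY]; split=> //; exists w; rewrite SE.
  by move=> [[w [/SE[_ ws] zw]] zY]; exists (cap w (points Y)); rewrite mem_cap.
Qed.

Lemma subspace_hausdorff : hausdorff X -> hausdorff Y.
Proof.
move=> haus x y hx hy ne.
have [u [v [hu [hv [xu [yv d]]]]]] := haus x y (proj1 YX _ hx) (proj1 YX _ hy) ne.
exists (cap u (points Y)), (cap v (points Y)); rewrite !mem_cap.
split; first exact: open_trace.
split; first exact: open_trace.
by split=> //; split=> // z; rewrite !mem_cap => -[/d zv _] [].
Qed.

Lemma subspace_enumerates e : enumerates_base X e -> exists e', enumerates_base Y e'.
Proof.
move=> [he hb]; have [|||e' [he' e'Q]] := @function_of_relation M omega (opens Y)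
  (fun k u => u = cap (app e k) (points Y)); first by definability.
- move=> k hk; eexists; split; last reflexivity.
  by apply: open_trace; apply: (app_cod he hk).
- by move=> k u v _ _ _ -> ->.
exists e'; split=> // v x; rewrite mem_opens_subspace => -[u [hu ->]].
rewrite mem_cap => -[xu xY]; have [k [hk [xk ku]]] := hb u x hu xu.
exists k; rewrite e'Q // mem_cap; split=> //; split=> // z.
by rewrite !mem_cap => -[/ku].
Qed.

Lemma converges_subspace s x : x ∈ points Y ->
  (forall n y, rel s n y -> y ∈ points Y) ->
  converges_to Y omega s x <-> converges_to X omega s x.
Proof.
move=> hx sY; split=> cv u hu xu.
  have [|n [hn h]] := cv _ (open_trace hu); first by rewrite mem_cap.
  by exists n; split=> // m y hm nm sy; have := h m y hm nm sy; rewrite mem_cap => -[].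
move: hu; rewrite mem_opens_subspace => -[v [hv ev]].
move: xu; rewrite ev mem_cap => -[xv _]; have [n [hn h]] := cv v hv xv.
by exists n; split=> // m y hm nm sy; rewrite mem_cap; split; [apply: h nm sy|apply: sY sy].
Qed.
End Given.
End Subspaces.

(** * Fréchet-Urysohn spaces *)

Section FrechetUrysohn.
Variable M : zf_model.
Implicit Types a b c e f g h k m n p q r s t u v w x y z : M.
Variable X : space M.
Hypothesis hX : is_topology X.
Hypothesis haus : hausdorff X.

Lemma constant_sequence a x : x ∈ a ->
  exists s, is_function s omega a /\ converges_to X omega s x.
Proof.
move=> xa; have [|||s [hs sQ]] := @function_of_relation M omega a (fun n y => y = x).
- by definability.
- by move=> _ _; exists x.
- by move=> n y y' _ _ _ -> ->.
exists s; split=> // u hu xu; exists zero; split; first exact: omega_zero.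
by move=> m y hm _; rewrite (rel_function hs) sQ // => -[_ <-].
Qed.

(** A convergent sequence together with its limit is a compact set that detects
    limit points. *)
Lemma frechet_urysohn_subspaces_k : frechet_urysohn X -> every_subspace_k_space X.
Proof.
move=> fu Y YX; have hY := subspace_topology hX YX.
split; first exact: (subspace_hausdorff YX haus).
move=> a aY hk; have aX : a ⊆ points X by move=> z /aY; apply: (proj1 YX).
rewrite closed_setE //; split=> // x xY xa; apply: contrapT => no.
have [|w [s []]] := fu a x aX.
  rewrite in_closureE //; split=> [|u hu xu]; first exact: (proj1 YX).
  apply: contrapT => no'; apply: no; exists (cap u (points Y)); rewrite mem_cap.
  split; first exact: (open_trace YX).
  by split=> // z; rewrite mem_cap => -[zu _ za]; apply: no'; exists z.
rewrite is_omegaE => -> [hs cv].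
have cvY : converges_to Y omega s x.
  by rewrite (converges_subspace YX) // => n y /(rel_dom hs)[_ /aY].
have := hk _ (cap a (with_limit Y s x)) (with_limit_compact hY hs aY xY cvY).
rewrite is_interE closed_setE // => /(_ erefl)[_ /(_ x xY)].
rewrite mem_cap => -[|u [hu [xu d]]]; first by case.
have [n [hn h]] := cvY u hu xu; have hsn := app_rel hs hn.
apply: (d (app s n)); first by apply: h hsn.
rewrite mem_cap (mem_with_limit _ hs) //; split; first exact: (app_cod hs).
by right; exists n.
Qed.

(** The [k]-property is used for the subspace that consists of [a] and the limit
    point. *)
Lemma subspaces_k_frechet_urysohn e : enumerates_base X e ->
  every_subspace_k_space X -> frechet_urysohn X.
Proof.
move=> he hk a x aX clx; exists omega.
suff [s hs] : exists s, is_function s omega a /\ converges_to X omega s x.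
  by exists s; rewrite is_omegaE.
have [xa|xa] := pselect (x ∈ a); first exact: constant_sequence.
have [hx cl] := proj1 (in_closureE hX x aX) clx.
have YX : is_subspace (subspace X (insert x a)) X.
  by apply: subspace_is_subspace => z; rewrite mem_insert => -[/aX|->].
have hY := subspace_topology hX YX.
have [e' he'] := subspace_enumerates YX he.
have aY : a ⊆ insert x a by move=> z za; rewrite mem_insert; left.
have xY : x ∈ insert x a by rewrite mem_insert; right.
have [|||s [hs cv]] := @k_space_sequence _ _ hY (proj1 (hk _ YX)) e' a x he' (hk _ YX).
- by move=> y /=; rewrite mem_insert.
- by [].
- rewrite in_closureE //; split=> // u; rewrite (mem_opens_subspace YX) => -[v [hv ->]].
  rewrite mem_cap => -[/(cl v hv)[z [zv za]] _]; exists z; rewrite mem_cap; split=> //.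
  by split=> //; apply: aY.
exists s; split=> //; rewrite -(converges_subspace YX) // => n y.
by move/(rel_dom hs) => -[_ /aY].
Qed.

(** Either the points of the subset are isolated in it, and each is named by a
    basic open set, or one of them is the limit of a sequence of others. *)
Lemma frechet_urysohn_infinite_closed e : enumerates_base X e ->
  frechet_urysohn X -> uncountable_subsets_contain_infinite_closed X.
Proof.
move=> he fu a aX unc.
have [x [xa acc]] : exists x, x ∈ a /\ forall u, u ∈ opens X -> x ∈ u ->
    exists y, y ∈ u /\ y ∈ a /\ y <> x.
  apply: contrapT => no; apply: unc; apply: (@countable_of_relation M a (fun x k =>
    x ∈ app e k /\ forall y, y ∈ a -> y ∈ app e k -> y = x)); first by definability.
    move=> x xa; apply: contrapT => no'; apply: no; exists x; split=> // u hu xu.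
    apply: contrapT => no; have [k [hk [xk ku]]] := proj2 he u x hu xu.
    apply: no'; exists k; split=> //; split=> // y ya yk.
    by apply: contrapT => yx; apply: no; exists y; split; first exact: ku.
  by move=> x y k xa ya _ [xk h] [yk _]; rewrite (h y).
have hx := aX x xa.
pose b := diff a (upair x x).
have bE y : y ∈ b <-> y ∈ a /\ y <> x by rewrite mem_diff mem_upair; tauto.
have bX : b ⊆ points X by move=> y /bE[/aX].
have [|w [s []]] := fu b x bX.
  rewrite in_closureE //; split=> // u hu /(acc u hu)[y [yu ya]].
  by exists y; rewrite bE.
rewrite is_omegaE => -> [hs cv]; have mK y := mem_with_limit y hs bX hx.
exists (with_limit X s x); split=> [y /mK[->//|[n [hn <-]]]|].
  by have /bE[] := app_cod hs hn.
split; last exact: (compact_closed hX haus (with_limit_compact hX hs bX hx cv)).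
move=> fin; have [u [hu [xu h]]] : exists u, u ∈ opens X /\ x ∈ u /\
    forall y, y ∈ with_limit X s x -> y ∈ u -> y = x.
  have : with_limit X s x ⊆ points X by move=> y /mK[->//|[n [hn <-]]]; apply/bX/(app_cod hs).
  move: (with_limit X s x) fin; apply: finite_ind; first by definability.
    by exists (points X); split; [exact: open_points|split=> // y /mem_zero].
  move=> t y IH ty; have [|u [hu [xu h]]] := IH.
    by move=> z zt; apply: ty; rewrite mem_insert; left.
  have [->|yx] := pselect (y = x).
    by exists u; split=> //; split=> // z; rewrite mem_insert => -[/h|->].
  have hy : y ∈ points X by apply: ty; rewrite mem_insert; right.
  have [v [v' [hv [_ [xv [yv' d]]]]]] := haus hx hy (fun E => yx (esym E)).
  exists (cap u v); split; first exact: open_cap.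
  rewrite mem_cap; split=> // z; rewrite mem_insert mem_cap => -[zt [zu _]|-> [_ /d]] //.
  exact: h.
have [n [hn hN]] := cv u hu xu; have hsn := app_rel hs hn.
have /bE[_] := app_cod hs hn; apply; apply: h; last by apply: hN hsn.
by rewrite mK; right; exists n.
Qed.

End FrechetUrysohn.

(** * The real line of the model as an ordered field *)

Section RealField.
Variable M : zf_model.
Variable R : field_data M.
Hypothesis hR : is_real_line R.
Implicit Types a b c f x y z : M.

Lemma is_function2E f a b c :
  is_function2 f a b c <-> is_function f (prod a b) c.
Proof.
have prodE p : is_product p a b <-> p = prod a b.
  split=> [h|->].
    apply: ext => z; rewrite mem_prod h.
    by split=> -[x [y [hx [hy]]]]; rewrite ?is_pairE => e; exists x, y; rewrite ?is_pairE.
  move=> z; rewrite mem_prod.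
  by split=> -[x [y [hx [hy]]]]; rewrite ?is_pairE => e; exists x, y; rewrite ?is_pairE.
by split=> [[p []]|h]; [rewrite prodE => ->|exists (prod a b); rewrite prodE].
Qed.

Lemma rel2E f x y z : rel2 f x y z <-> rel f (opair x y) z.
Proof.
split=> [[p []]|h]; first by rewrite is_pairE => ->.
by exists (opair x y); rewrite is_pairE.
Qed.

(** The reals of the model as a real field of the metatheory, which makes
    ordinary algebra available; completeness remains about sets of the model. *)
Record real_coordinates := RealCoordinates {
  real_field : realFieldType;
  coord : real_field -> M;
  coord_in : forall u, coord u ∈ Rset R;
  coord_inj : injective coord;
  coord_onto : forall x, x ∈ Rset R -> exists u, x = coord u;
  coord_zero : Rzero R = coord 0%R;
  coord_add : forall u v z, rel2 (Radd R) (coord u) (coord v) z <-> z = coord (u + v)%R;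
  coord_mul : forall u v z, rel2 (Rmul R) (coord u) (coord v) z <-> z = coord (u * v)%R;
  coord_le : forall u v, leR R (coord u) (coord v) <-> (u <= v)%R;
  coord_sup : forall s : M, s ⊆ Rset R -> nonempty s ->
    (exists b : real_field, forall u, coord u ∈ s -> (u <= b)%R) ->
    exists l, (forall u, coord u ∈ s -> (u <= l)%R) /\
      forall b : real_field, (forall u, coord u ∈ s -> (u <= b)%R) -> (l <= b)%R
}.

Let ord := proj1 hR.
Let fld := ordered_field_field ord.

(** The hypothesis is an argument of this type so that the algebraic structures
    built from it can be attached to the type. *)
Definition reals (h : is_real_line R) : Type := {x : M | x ∈ Rset R}.
Local Notation T := (reals hR).
Implicit Types u v w : T.

Let val (u : T) : M := sval u.
Let valP u : val u ∈ Rset R := svalP u.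
Let val_inj u v : val u = val v -> u = v.
Proof.
by case: u v => [x hx] [y hy] /= e; subst y; congr exist; apply: Prop_irrelevance.
Qed.

Definition op2 f (hf : is_function2 f (Rset R) (Rset R) (Rset R)) u v : T.
Proof.
exists (app f (opair (val u) (val v))).
by apply: app_cod (proj1 (is_function2E _ _ _ _) hf) _ _; rewrite mem_opair_prod.
Defined.

Lemma op2P f hf u v z : rel2 f (val u) (val v) z <-> z = val (@op2 f hf u v).
Proof.
rewrite rel2E (rel_function (proj1 (is_function2E _ _ _ _) hf)) mem_opair_prod.
by split=> [[_ <-]|->] //; do 2 split; apply: valP.
Qed.

Let add := op2 (add_function fld).
Let mul := op2 (mul_function fld).
Let addP u v z : rel2 (Radd R) (val u) (val v) z <-> z = val (add u v).
Proof. exact: op2P. Qed.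
Let mulP u v z : rel2 (Rmul R) (val u) (val v) z <-> z = val (mul u v).
Proof. exact: op2P. Qed.
Let zeroT : T := exist _ (Rzero R) (zero_in fld).
Let oneT : T := exist _ (Rone R) (one_in fld).

Let opp_ex u : exists v, add u v = zeroT.
Proof.
have [y [hy]] := add_inverse fld _ (valP u).
by rewrite (addP u (exist _ y hy)) => e; exists (exist _ y hy); apply: val_inj.
Qed.
Let opp u : T := projT1 (cid (opp_ex u)).

Let inv_ex u : exists v, (u <> zeroT -> mul u v = oneT) /\ (u = zeroT -> v = zeroT).
Proof.
have [->|nz] := pselect (u = zeroT); first by exists zeroT.
have [|y [hy]] := mul_inverse fld (valP u); first by move=> e; apply/nz/val_inj.
rewrite (mulP u (exist _ y hy)) => e; exists (exist _ y hy); split=> // _.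
exact: val_inj.
Qed.
Let inv u : T := projT1 (cid (inv_ex u)).

Let addC : commutative add.
Proof. by move=> u v; apply: val_inj; apply/addP; apply: (add_comm fld); apply/addP. Qed.
Let addA : associative add.
Proof.
move=> u v w; apply: esym; apply: val_inj; apply/addP.
by apply: (add_assoc fld) (_ : rel2 _ (val u) (val v) _) _ _; apply/addP.
Qed.
Let add0 : left_id zeroT add.
Proof. by move=> u; rewrite addC; apply: val_inj; apply: esym; apply/addP; apply: (add_zero fld); apply: valP. Qed.
Let addN : left_inverse zeroT opp add.
Proof. by move=> u; rewrite addC /opp; case: (cid _). Qed.
Let mulC : commutative mul.
Proof. by move=> u v; apply: val_inj; apply/mulP; apply: (mul_comm fld); apply/mulP. Qed.
Let mulA : associative mul.
Proof.
move=> u v w; apply: esym; apply: val_inj; apply/mulP.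
by apply: (mul_assoc fld) (_ : rel2 _ (val u) (val v) _) _ _; apply/mulP.
Qed.
Let mul1 : left_id oneT mul.
Proof. by move=> u; rewrite mulC; apply: val_inj; apply: esym; apply/mulP; apply: (mul_one fld); apply: valP. Qed.
Let mulD : left_distributive mul add.
Proof.
move=> u v w; rewrite mulC (mulC u) (mulC v); apply: val_inj; apply/addP.
apply: (mul_add_distr fld) (_ : rel2 _ (val u) (val v) _) _ _ _; last by apply/mulP.
- exact/addP.
- exact/mulP.
- exact/mulP.
Qed.

HB.instance Definition _ := gen_eqMixin T.
HB.instance Definition _ := gen_choiceMixin T.
HB.instance Definition _ := GRing.isZmodule.Build T addA addC add0 addN.

Let one_neq0 : oneT != 0%R :> T.
Proof. by apply/eqP => e; apply: (one_neq_zero fld); rewrite -[Rone R]/(val oneT) e. Qed.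

HB.instance Definition _ :=
  GRing.Zmodule_isComNzRing.Build T mulA mulC mul1 mulD one_neq0.

Let mulV u : u != 0%R -> (inv u * u)%R = 1%R.
Proof.
move=> /eqP nz; rewrite GRing.mulrC /inv; case: (cid _) => v /= [h _]; exact: h.
Qed.
Let inv0 : inv 0%R = 0%R.
Proof. by rewrite /inv; case: (cid _) => v /= [_ h]; apply: h. Qed.

HB.instance Definition _ := GRing.ComNzRing_isField.Build T mulV inv0.

Let le u v : bool := `[< leR R (val u) (val v) >].
Let lt u v : bool := (v != u) && le u v.
Let norm u : T := if le 0%R u then u else (- u)%R.

Let le_addr u v w : le u v -> le (u + w)%R (v + w)%R.
Proof.
move=> /asboolP h; apply/asboolP.
by apply: (le_add ord (valP u) (valP v) (valP w) h); apply/addP.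
Qed.
Let sub_ge0 u v : le 0%R (v - u)%R = le u v.
Proof.
apply/idP/idP => h; first by have := le_addr u h; rewrite GRing.add0r GRing.subrK.
by have := le_addr (- u)%R h; rewrite GRing.subrr.
Qed.
Let le0_anti u : le 0%R u -> le u 0%R -> u = 0%R.
Proof.
by move=> /asboolP h1 /asboolP h2; apply: val_inj; apply: (le_antisym ord) h2 h1; apply: valP.
Qed.
Let le0_add u v : le 0%R u -> le 0%R v -> le 0%R (u + v)%R.
Proof.
move=> h1 h2; have := le_addr u h2; rewrite GRing.add0r GRing.addrC => /asboolP h3.
apply/asboolP; apply: (le_trans ord) h3; try exact: valP.
exact/asboolP.
Qed.
Let le0_mul u v : le 0%R u -> le 0%R v -> le 0%R (u * v)%R.
Proof.
move=> /asboolP h1 /asboolP h2; apply/asboolP.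
by apply: (le_mul ord (valP u) (valP v) h1 h2); apply/mulP.
Qed.
Let le0_total u : le 0%R u || le u 0%R.
Proof.
by apply/orP; case: (le_total ord _ _ (valP 0%R) (valP u)) => h; [left|right]; apply/asboolP.
Qed.
Let le0N u : le 0%R (- u)%R = le u 0%R.
Proof. by rewrite -(sub_ge0 u 0%R) GRing.sub0r. Qed.
Let normN u : norm (- u)%R = norm u.
Proof.
rewrite /norm le0N; have := le0_total u.
case h1 : (le 0%R u); case h2 : (le u 0%R) => //= _.
  by rewrite (le0_anti h1 h2) GRing.oppr0.
by rewrite GRing.opprK.
Qed.
Let ge0_norm u : le 0%R u -> norm u = u.
Proof. by rewrite /norm => ->. Qed.

HB.instance Definition _ := Num.IntegralDomain_isLeReal.Build T le0_add le0_mul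
  le0_anti sub_ge0 le0_total normN ge0_norm (fun _ _ => erefl).

Lemma real_coordinates_exist : exists K : real_coordinates, True.
Proof.
have leP u v : leR R (val u) (val v) <-> (u <= v)%R by split=> [/asboolP|/asboolP].
unshelve eexists (@RealCoordinates (reals hR : realFieldType) val _ _ _ _ _ _ _ _) => //.
- by move=> x hx; exists (exist _ x hx).
- move=> s ss ns [b hb]; have [|l [[hl ub] lub]] := proj2 hR s ss ns.
    exists (val b); split; first exact: valP.
    by move=> x xs; have := hb (exist _ x (ss _ xs)) xs; rewrite -leP.
  exists (exist _ l hl); split=> [u us|c hc]; first by rewrite -leP; apply: ub.
  rewrite -leP; apply: lub; split; first exact: valP.
  by move=> x xs; have := hc (exist _ x (ss _ xs)) xs; rewrite -leP.
Qed.

End RealField.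
Arguments coord {M R} r u.
Arguments coord_in {M R} r u.
Arguments coord_inj {M R} r [x1 x2] _.
Arguments coord_onto {M R} r [x] _.
Arguments coord_zero {M R} r.
Arguments coord_add {M R} r u v z.
Arguments coord_mul {M R} r u v z.
Arguments coord_le {M R} r u v.
Arguments coord_sup {M R} r [s] _ _ _.

(** * Sequences of reals *)

Section Chains.
Variable M : zf_model.
Implicit Types k m n : M.

Lemma omega_chain (Q : M -> M -> Prop) :
  @definable M 2 (fun c : unit * M * M => Q (snd (fst c)) (snd c)) ->
  (forall n, n ∈ omega -> Q n n) ->
  (forall n m, n ∈ omega -> m ∈ omega -> Q n m -> Q n (succ m)) ->
  forall n m, n ∈ omega -> m ∈ omega -> n ⊆ m -> Q n m.
Proof.
move=> dQ refl step n m hn; move: m; apply: omega_ind; first by definability.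
  rewrite nat_subset //; last exact: omega_zero.
  by rewrite mem_succ => -[/mem_zero|->] //; apply: refl; exact: omega_zero.
move=> m hm IH; rewrite nat_subset //; last exact: omega_succ.
rewrite mem_succ => -[h|->]; last by apply: refl; apply: omega_succ.
by apply: step => //; apply: IH; rewrite nat_subset.
Qed.

(** Cantor's walk along the diagonals of the quadrant. *)
Definition diagonal_step (y y' : M) : Prop := exists a b, y = opair a b /\
  ((b = zero /\ y' = opair zero (succ a)) \/
   exists b', b' ∈ omega /\ b = succ b' /\ y' = opair (succ a) b').

Lemma diagonal_step0 a y : diagonal_step (opair a zero) y -> y = opair zero (succ a).
Proof.
move=> [a' [b [/opair_inj[<- <-] [[_ ->]//|[b' [_ [/zero_not_succ]]]]]]] //.
Qed.

Lemma diagonal_stepS a b y : b ∈ omega ->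
  diagonal_step (opair a (succ b)) y -> y = opair (succ a) b.
Proof.
move=> hb [a' [b1 [/opair_inj[<- <-] [[/esym/zero_not_succ//]|[b' [hb' [e ->]]]]]]].
by rewrite (succ_inj hb hb' e).
Qed.

Lemma diagonal_walk : exists f : M, is_function f omega (prod omega omega) /\
  app f zero = opair zero zero /\
  forall n, n ∈ omega -> diagonal_step (app f n) (app f (succ n)).
Proof.
have d : @definable M 3 (fun c : unit * M * M * M =>
  (fun _ => diagonal_step) (snd (fst (fst c))) (snd (fst c)) (snd c)).
  by definability.
apply: (@recursion M (prod omega omega) (opair zero zero) (fun _ => diagonal_step) d).
- by rewrite mem_opair_prod; split; exact: omega_zero.
- move=> n y _; rewrite mem_prod => -[a [b [ha [hb ->]]]].
  have [->|[b' [hb' ->]]] := nat_case hb.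
    exists (opair zero (succ a)); rewrite mem_opair_prod; split; last by exists a, zero; split=> //; left.
    by split; [exact: omega_zero|exact: omega_succ].
  exists (opair (succ a) b'); rewrite mem_opair_prod; split; first by split=> //; apply: omega_succ.
  by exists a, (succ b'); split=> //; right; exists b'.
move=> n y y1 y2 _; rewrite mem_prod => -[a [b [ha [hb ->]]]].
have [->|[b' [hb' ->]]] := nat_case hb; first by move=> /diagonal_step0 -> /diagonal_step0 ->.
by move=> /(diagonal_stepS hb') -> /(diagonal_stepS hb') ->.
Qed.
End Chains.

Section RealSequences.
Variable M : zf_model.
Variable R : field_data M.
Variable K : real_coordinates R.
Implicit Types a b f k m n p x y z S T : M.

Local Notation F := (real_field K).
Local Notation "# u" := (coord K u) (at level 8, format "# u").
Implicit Types u v w : F.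

Definition addM x y : M := app (Radd R) (opair x y).
Definition mulM x y : M := app (Rmul R) (opair x y).

Lemma addM_coord u v : addM #u #v = #(u + v)%R.
Proof.
apply: rel_app => [y|]; rewrite -rel2E; last by apply/coord_add.
by move/coord_add.
Qed.

Lemma mulM_coord u v : mulM #u #v = #(u * v)%R.
Proof.
apply: rel_app => [y|]; rewrite -rel2E; last by apply/coord_mul.
by move/coord_mul.
Qed.

Lemma value_subproof x : exists u, (x ∈ Rset R -> x = #u) /\ (x ∉ Rset R -> u = 0%R).
Proof.
have [h|h] := pselect (x ∈ Rset R); last by exists 0%R.
by have [u ->] := coord_onto K h; exists u; split=> // -[]; apply: coord_in.
Qed.
(** The inverse of [coord]; the default [0] keeps it definable. *)
Definition value x : F := projT1 (cid (value_subproof x)).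

Lemma valueK x : x ∈ Rset R -> #(value x) = x.
Proof. by rewrite /value; case: (cid _) => u /= [h _] /h. Qed.

Lemma value_default x : x ∉ Rset R -> value x = 0%R.
Proof. by rewrite /value; case: (cid _) => u /= [_ h] /h. Qed.

Lemma coordK u : value #u = u.
Proof. by apply: (coord_inj K); rewrite valueK //; apply: coord_in. Qed.

Lemma leR_value x y : x ∈ Rset R -> y ∈ Rset R ->
  leR R x y <-> (value x <= value y)%R.
Proof. by move=> hx hy; rewrite -coord_le !valueK. Qed.

Lemma definable_term_value (n : nat) (t : ctx M n -> M) : definable_term t ->
  definable_term (fun c => #(value (t c))).
Proof.
apply: (@definable_term1 _ _ (fun x => #(value x))).
apply: (@definable_ext _ 2 (fun c : unit * M * M => (c.1.2 ∈ Rset R /\ c.2 = c.1.2) \/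
  (c.1.2 ∉ Rset R /\ c.2 = #0%R))) => [[[_ x] y]|] /=; last by definability.
have [h|h] := pselect (x ∈ Rset R); first by rewrite valueK //; tauto.
by rewrite value_default //; tauto.
Qed.

Lemma definable_term_add (n : nat) (g h : ctx M n -> F) :
  definable_term (fun c => #(g c)) -> definable_term (fun c => #(h c)) ->
  definable_term (fun c => #(g c + h c)%R).
Proof.
move=> dg dh; apply: (@definable_ext _ n.+1 (fun c : ctx M n * M =>
  c.2 = addM #(g c.1) #(h c.1))) => [c|]; first by rewrite addM_coord.
have dF : @definable M 3 (fun c : unit * M * M * M => c.2 = addM c.1.1.2 c.1.2).
  by definability.
exact: (definable_term2 dF dg dh).
Qed.

Lemma definable_term_mul (n : nat) (g h : ctx M n -> F) :
  definable_term (fun c => #(g c)) -> definable_term (fun c => #(h c)) ->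
  definable_term (fun c => #(g c * h c)%R).
Proof.
move=> dg dh; apply: (@definable_ext _ n.+1 (fun c : ctx M n * M =>
  c.2 = mulM #(g c.1) #(h c.1))) => [c|]; first by rewrite mulM_coord.
have dF : @definable M 3 (fun c : unit * M * M * M => c.2 = mulM c.1.1.2 c.1.2).
  by definability.
exact: (definable_term2 dF dg dh).
Qed.

Lemma definable_term_opp (n : nat) (g : ctx M n -> F) :
  definable_term (fun c => #(g c)) -> definable_term (fun c => #(- g c)%R).
Proof.
move=> dg; have := definable_term_mul (definable_term_const #(-1)%R) dg.
by apply: definable_ext => c; rewrite GRing.mulN1r.
Qed.

Lemma definable_real_eq (n : nat) (g h : ctx M n -> F) :
  definable_term (fun c => #(g c)) -> definable_term (fun c => #(h c)) ->
  definable (fun c => g c = h c).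
Proof.
move=> dg dh; apply: definable_ext (definable_eq dg dh) => c.
by split=> [/(coord_inj K)|->].
Qed.

Lemma definable_real_le (n : nat) (g h : ctx M n -> F) :
  definable_term (fun c => #(g c)) -> definable_term (fun c => #(h c)) ->
  definable (fun c => (g c <= h c)%R).
Proof.
move=> dg dh; apply: (@definable_ext _ _ (fun c => leR R #(g c) #(h c))) => [c|].
  exact: coord_le.
have dQ : @definable M 2 (fun c : unit * M * M => leR R c.1.2 c.2) by definability.
exact: (definable_subst2 dQ dg dh).
Qed.

Lemma definable_real_lt (n : nat) (g h : ctx M n -> F) :
  definable_term (fun c => #(g c)) -> definable_term (fun c => #(h c)) ->
  definable (fun c => (g c < h c)%R).
Proof.
move=> dg dh; apply: definable_ext (definable_not (definable_real_le dh dg)) => c.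
by rewrite Order.TotalTheory.ltNge; split=> /negP.
Qed.

Section Values.
Variable f : M.
Hypothesis hf : is_function f omega (Rset R).

Definition term n : F := value (app f n).

Lemma coord_term n : n ∈ omega -> #(term n) = app f n.
Proof. by move=> hn; apply: valueK; apply: (app_cod hf). Qed.

Lemma bounded_sup : (exists b : F, forall n, n ∈ omega -> (term n <= b)%R) ->
  exists l : F, (forall n, n ∈ omega -> (term n <= l)%R) /\
    forall b : F, (forall n, n ∈ omega -> (term n <= b)%R) -> (l <= b)%R.
Proof.
move=> [b hb]; pose s := sep (Rset R) (fun x => exists n, n ∈ omega /\ x = app f n).
have sE u : #u ∈ s <-> exists n, n ∈ omega /\ u = term n.
  rewrite /s; rewrite_sep; split=> [[_ [n [hn e]]]|[n [hn ->]]].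
    by exists n; split=> //; rewrite /term -e coordK.
  by split; [exact: coord_in|exists n; rewrite coord_term].
have [x|||l [h1 h2]] := @coord_sup _ _ K s.
- by rewrite /s; rewrite_sep => -[].
- by exists #(term zero); rewrite sE; exists zero; split=> //; exact: omega_zero.
- by exists b => u /sE[n [hn ->]]; apply: hb.
exists l; split=> [n hn|c hc]; first by apply: h1; rewrite sE; exists n.
by apply: h2 => u /sE[n [hn ->]]; apply: hc.
Qed.
End Values.

(** The step is given as a definable operation of the model, which makes recursion
    possible, and as a function on coordinates, which is what proofs need. *)
Lemma real_recursion (t : M -> M) (g : F -> F) u0 :
  @definable_term M 1 (fun c : unit * M => t (snd c)) ->
  (forall u, t #u = #(g u)) ->
  exists f, is_function f omega (Rset R) /\ term f zero = u0 /\
    forall n, n ∈ omega -> term f (succ n) = g (term f n).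
Proof.
move=> dt tg; have dQ : @definable M 3 (fun c : unit * M * M * M =>
    (fun _ y y' => y' = t y) (snd (fst (fst c))) (snd (fst c)) (snd c)).
  by refine (definable_eq _ (definable_term1 dt _)); definability.
have [n y _ hy|n y y1 y2 _ _ -> ->|f [hf [f0 fS]]] :=
  @recursion M (Rset R) #u0 (fun _ y y' => y' = t y) dQ (coord_in K u0) => //.
  by exists (t y); split=> //; rewrite -(valueK hy) tg; apply: coord_in.
exists f; split=> //; split=> [|n hn]; first by rewrite /term f0 coordK.
by rewrite /term fS // -{1}(coord_term hf hn) tg coordK.
Qed.

Lemma naturals : exists f, is_function f omega (Rset R) /\ term f zero = 0%R /\
  forall n, n ∈ omega -> term f (succ n) = (term f n + 1)%R.
Proof.
apply: (@real_recursion (fun y => addM y #1%R) (fun u => u + 1)%R).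
  by definability.
by move=> u; rewrite addM_coord.
Qed.

Lemma powers : exists f, is_function f omega (Rset R) /\ term f zero = 1%R /\
  forall n, n ∈ omega -> term f (succ n) = (3%:R^-1 * term f n)%R.
Proof.
apply: (@real_recursion (fun y => mulM #(3%:R^-1)%R y) (fun u => 3%:R^-1 * u)%R).
  by definability.
by move=> u; rewrite mulM_coord.
Qed.

End RealSequences.
Arguments bounded_sup {M R} K [f] _ _.

Ltac definability_reals :=
  match goal with
  | |- definable (fun _ => is_true (Order.le _ _)) => refine (definable_real_le _ _)
  | |- definable (fun _ => is_true (Order.lt _ _)) => refine (definable_real_lt _ _)
  | |- definable (fun _ => _ = _) => refine (definable_real_eq _ _)
  | |- definable_term (fun _ => coord _ (value _ _)) =>
      refine (definable_term_value _ _)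
  | |- definable_term (fun _ => coord _ (GRing.add _ _)) =>
      refine (definable_term_add _ _)
  | |- definable_term (fun _ => coord _ (GRing.mul _ _)) =>
      refine (definable_term_mul _ _)
  | |- definable_term (fun _ => coord _ (GRing.opp _)) =>
      refine (definable_term_opp _)
  | |- definable_term (fun c => coord _ (?h (@?x c))) => unfold_head h
  | |- definable_term (fun c => coord _ (?h (@?x c) (@?y c))) => unfold_head h
  end.
Ltac definability_hook ::=
  first [definability_reals | definability_functions | definability_pairs
        | definability_sets].

(** * Pairing, the Cantor map and a countable dense set *)

Section RealFacts.
Variable M : zf_model.
Variable R : field_data M.
Variable K : real_coordinates R.
Implicit Types a b f k m n p x y z S T : M.
Local Notation F := (real_field K).
Local Notation "# u" := (coord K u) (at level 8, format "# u").
Local Notation "f ⟦ n ⟧" := (term K f n)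
  (at level 2, n at level 200, left associativity, format "f ⟦ n ⟧").
Implicit Types u v w : F.
Local Open Scope ring_scope.

Definition is_naturals f : Prop := is_function f omega (Rset R) /\
  f⟦zero⟧ = 0 /\ forall n, n ∈ omega -> f⟦succ n⟧ = f⟦n⟧ + 1.

Definition is_powers f : Prop := is_function f omega (Rset R) /\
  f⟦zero⟧ = 1 /\ forall n, n ∈ omega -> f⟦succ n⟧ = 3%:R^-1 * f⟦n⟧.

Section Naturals.
Variable nu : M.
Hypothesis hnu : is_naturals nu.

Lemma naturals_ge0 n : n ∈ omega -> 0 <= nu⟦n⟧.
Proof.
have [_ [nu0 nuS]] := hnu; move: n; apply: omega_ind; first by definability.
  by rewrite nu0.
by move=> n hn IH; rewrite nuS //; lra.
Qed.

Lemma naturals_lt m n : n ∈ omega -> m ∈ n -> nu⟦m⟧ < nu⟦n⟧.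
Proof.
have [_ [nu0 nuS]] := hnu.
move=> hn; move: n hn m; apply: omega_ind; first by definability.
  by move=> m /mem_zero.
by move=> n hn IH m; rewrite mem_succ nuS // => -[/IH|->]; lra.
Qed.

Lemma naturals_inj m n : m ∈ omega -> n ∈ omega -> nu⟦m⟧ = nu⟦n⟧ -> m = n.
Proof.
move=> hm hn e; have [/(naturals_lt hn)|[//|/(naturals_lt hm)]] := nat_total hm hn;
  by rewrite e Order.POrderTheory.ltxx.
Qed.

(** If [l] were the supremum of the naturals, [l - 1] would be an upper bound, since
    adding [1] to a natural gives a natural. *)
Lemma naturals_archimedean u : exists n, n ∈ omega /\ u < nu⟦n⟧.
Proof.
have [hf [nu0 nuS]] := hnu; apply: contrapT => no.
have ub n : n ∈ omega -> nu⟦n⟧ <= u.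
  by move=> hn; rewrite Order.TotalTheory.leNgt; apply/negP => h; apply: no; exists n.
have [|l [h1 h2]] := bounded_sup K hf; first by exists u.
have : l <= l - 1.
  apply: h2 => n hn; have := h1 _ (omega_succ hn); rewrite nuS //; lra.
lra.
Qed.

Lemma naturals_add m n : m ∈ omega -> n ∈ omega ->
  exists k, k ∈ omega /\ nu⟦k⟧ = nu⟦m⟧ + nu⟦n⟧.
Proof.
have [_ [nu0 nuS]] := hnu; move=> hm; move: n; apply: omega_ind; first by definability.
  by exists m; split=> //; rewrite nu0; lra.
move=> n hn [k [hk e]]; exists (succ k); split; first exact: omega_succ.
by rewrite !nuS // e; lra.
Qed.

(** Every pair is met, by induction on its diagonal and then along the diagonal.
    The sum of two naturals, which numbers the diagonal, is taken in the reals, so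
    that addition need not be defined on [omega]. *)
Lemma pairing_onto : exists h1 h2 : M,
  is_function h1 omega omega /\ is_function h2 omega omega /\
  (forall k, k ∈ omega -> app h1 k ∈ succ k) /\
  forall a b, a ∈ omega -> b ∈ omega ->
    exists k, k ∈ omega /\ app h1 k = a /\ app h2 k = b.
Proof.
have [_ [nu0 nuS]] := hnu.
have [f [hf [f0 fS]]] := diagonal_walk M.
have hit s : s ∈ omega -> forall a, a ∈ omega -> forall b, b ∈ omega ->
    nu⟦a⟧ + nu⟦b⟧ = nu⟦s⟧ -> exists k, k ∈ omega /\ app f k = opair a b.
  move: s; apply: omega_ind; first by definability.
    move=> a ha b hb e; exists zero; split; first exact: omega_zero.
    have za := naturals_ge0 ha; have zb := naturals_ge0 hb.
    rewrite f0; congr opair; apply: naturals_inj => //; try exact: omega_zero.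
    - by move: e; rewrite nu0; lra.
    - by move: e; rewrite nu0; lra.
  move=> s hs IH; apply: omega_ind; first by definability.
    move=> b hb; rewrite nu0 => e.
    have -> : b = succ s by apply: naturals_inj => //; [exact: omega_succ|lra].
    have [|k [hk e2]] := IH s hs zero omega_zero; first by rewrite nu0; lra.
    exists (succ k); split; first exact: omega_succ.
    by apply: diagonal_step0; rewrite -e2; apply: fS.
  move=> a ha IHa b hb e.
  have [|k [hk e2]] := IHa (succ b) (omega_succ hb).
    by move: e; rewrite !nuS //; lra.
  exists (succ k); split; first exact: omega_succ.
  by apply: (diagonal_stepS hb); rewrite -e2; apply: fS.
have fP k : k ∈ omega -> exists a b, a ∈ omega /\ b ∈ omega /\ app f k = opair a b.
  by move=> hk; have := app_cod hf hk; rewrite mem_prod.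
have [|||h1 [hh1 h1P]] := @function_of_relation M omega omega
  (fun k a => exists b, app f k = opair a b); first by definability.
- by move=> k /fP[a [b [ha [hb e]]]]; exists a; split=> //; exists b.
- by move=> k a a' _ _ _ [b ->] [b' /opair_inj[]].
have [|||h2 [hh2 h2P]] := @function_of_relation M omega omega
  (fun k b => exists a, app f k = opair a b); first by definability.
- by move=> k /fP[a [b [ha [hb e]]]]; exists b; split=> //; exists a.
- by move=> k b b' _ _ _ [a ->] [a' /opair_inj[]].
have h1E k a b : k ∈ omega -> app f k = opair a b -> app h1 k = a.
  by move=> hk e; have [b'] := h1P k hk; rewrite e => /opair_inj[].
have h2E k a b : k ∈ omega -> app f k = opair a b -> app h2 k = b.
  by move=> hk e; have [a'] := h2P k hk; rewrite e => /opair_inj[].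
exists h1, h2; split=> //; split=> //; split.
  apply: omega_ind; first by definability.
    by rewrite (h1E _ _ _ omega_zero f0) mem_succ; right.
  move=> k hk IH; have [a [b [ha [hb e]]]] := fP k hk.
  have := fS k hk; rewrite e; have [->|[b' [hb' ->]]] := nat_case hb.
    move/diagonal_step0 => e'; rewrite (h1E _ _ _ (omega_succ hk) e').
    by apply: zero_mem_succ; apply: omega_succ.
  move/(diagonal_stepS hb') => e'; rewrite (h1E _ _ _ (omega_succ hk) e').
  by apply: succ_mem_succ; [exact: omega_succ|rewrite -(h1E _ _ _ hk e)].
move=> a b ha hb; have [s [hs e]] := naturals_add ha hb.
have [k [hk e2]] := hit s hs a ha b hb (esym e); exists k; split=> //.
by rewrite (h1E _ _ _ hk e2) (h2E _ _ _ hk e2).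
Qed.

End Naturals.

Section Powers.
Variable pw : M.
Hypothesis hpw : is_powers pw.

Lemma powers_gt0 n : n ∈ omega -> 0 < pw⟦n⟧.
Proof.
have [_ [pw0 pwS]] := hpw; move: n; apply: omega_ind; first by definability.
  by rewrite pw0; lra.
by move=> n hn IH; rewrite pwS //; lra.
Qed.

Lemma powers_antitone m n : m ∈ omega -> n ∈ omega -> m ⊆ n -> pw⟦n⟧ <= pw⟦m⟧.
Proof.
have [_ [pw0 pwS]] := hpw; apply: (@omega_chain M (fun m n => pw⟦n⟧ <= pw⟦m⟧)).
- by definability.
- by move=> k _; lra.
- by move=> k l hk hl; rewrite pwS //; have := powers_gt0 hl; lra.
Qed.

(** The supremum [l] of the numbers [- pw⟦n⟧] satisfies [l <= 3 * l]. *)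
Lemma powers_small u : 0 < u -> exists n, n ∈ omega /\ pw⟦n⟧ < u.
Proof.
have [hf [pw0 pwS]] := hpw; move=> u0; apply: contrapT => no.
have lb n : n ∈ omega -> u <= pw⟦n⟧.
  by move=> hn; rewrite Order.TotalTheory.leNgt; apply/negP => h; apply: no; exists n.
pose s := sep (Rset R) (fun x => exists n, n ∈ omega /\ x = mulM R #(-1) (app pw n)).
have sE v : #v ∈ s <-> exists n, n ∈ omega /\ v = - pw⟦n⟧.
  rewrite /s; rewrite_sep; split=> [[_ [n [hn]]]|[n [hn ->]]].
    rewrite -(coord_term K hf hn) mulM_coord => /(coord_inj K) ->; exists n; split=> //; lra.
  split; [exact: coord_in|exists n; split=> //].
  by rewrite -(coord_term K hf hn) mulM_coord; congr #_; lra.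
have [x|||l [h1 h2]] := @coord_sup _ _ K s.
- by rewrite /s; rewrite_sep => -[].
- by exists #(- pw⟦zero⟧); rewrite sE; exists zero; split=> //; exact: omega_zero.
- by exists 0 => v /sE[n [hn ->]]; have := powers_gt0 hn; lra.
have l1 : l <= - u by apply: h2 => v /sE[n [hn ->]]; have := lb n hn; lra.
have : l <= 3%:R * l.
  apply: h2 => v /sE[n [hn ->]]; have /h1 : #(- pw⟦succ n⟧) ∈ s.
    by rewrite sE; exists (succ n); split=> //; apply: omega_succ.
  rewrite pwS //; lra.
lra.
Qed.

(** The ternary expansion with digit [1] at the places in [S] and [0]
    elsewhere. *)
Definition is_partial_sums S f : Prop := is_function f omega (Rset R) /\
  f⟦zero⟧ = 0 /\ forall n, n ∈ omega ->
    (n ∈ S /\ f⟦succ n⟧ = f⟦n⟧ + pw⟦n⟧) \/ (n ∉ S /\ f⟦succ n⟧ = f⟦n⟧).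

(** The supremum of the partial sums is spelled out by formulas, so that the
    Cantor map is definable. *)
Definition is_cantor_value S x : Prop := exists f, is_partial_sums S f /\
  (forall n, n ∈ omega -> f⟦n⟧ <= value K x) /\
  forall y, y ∈ Rset R -> (forall n, n ∈ omega -> f⟦n⟧ <= value K y) ->
    value K x <= value K y.

Lemma definable_cantor_value (n : nat) (s t : ctx M n -> M) : definable_term s ->
  definable_term t -> definable (fun c => is_cantor_value (s c) (t c)).
Proof.
by apply: definable_subst2; definability.
Qed.

Lemma partial_sums_exist S : exists f, is_partial_sums S f.
Proof.
have [hf [pw0 pwS]] := hpw.
pose Q n y y' := (n ∈ S /\ y' = addM R y (app pw n)) \/ (n ∉ S /\ y' = y).
have dQ : @definable M 3 (fun c : unit * M * M * M =>
  Q (snd (fst (fst c))) (snd (fst c)) (snd c)) by definability.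
have [|n y hn hy|n y y1 y2 _ _|f [hs [f0 fS]]] := @recursion M (Rset R) #0 Q dQ.
- exact: coord_in.
- have [nS|nS] := pselect (n ∈ S); last by exists y; split=> //; right.
  exists (addM R y (app pw n)); split; last by left.
  by rewrite -(valueK K hy) -(coord_term K hf hn) addM_coord; apply: coord_in.
- by move=> [[? ->]|[? ->]] [[? ->]|[? ->]].
exists f; split=> //; split=> [|n hn]; first by rewrite /term f0 coordK.
case: (fS n hn) => -[nS e]; [left|right]; split=> //; rewrite /term e //.
by rewrite -(coord_term K hs hn) -(coord_term K hf hn) addM_coord !coordK.
Qed.

Lemma partial_sums_agree S T f g n : is_partial_sums S f -> is_partial_sums T g ->
  n ∈ omega -> (forall k, k ∈ n -> k ∈ S <-> k ∈ T) -> f⟦n⟧ = g⟦n⟧.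
Proof.
move=> [_ [f0 fS]] [_ [g0 gS]]; move: n; apply: omega_ind; first by definability.
  by rewrite f0 g0.
move=> n hn IH ag; have e : f⟦n⟧ = g⟦n⟧.
  by apply: IH => k kn; apply: ag; rewrite mem_succ; left.
have agn : n ∈ S <-> n ∈ T by apply: ag; rewrite mem_succ; right.
by case: (fS n hn) => -[inS ->]; case: (gS n hn) => -[inT ->]; rewrite ?e //; tauto.
Qed.

Lemma partial_sums_increasing S f m n : is_partial_sums S f ->
  m ∈ omega -> n ∈ omega -> m ⊆ n -> f⟦m⟧ <= f⟦n⟧.
Proof.
move=> [_ [f0 fS]]; apply: (@omega_chain M (fun m n => f⟦m⟧ <= f⟦n⟧)).
- by definability.
- by move=> k _; lra.
- by move=> k l hk hl; have := powers_gt0 hl; case: (fS l hl) => -[_ ->]; lra.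
Qed.

(** The tail of the geometric series starting at [n] is [3 / 2 * pw⟦n⟧]. *)
Lemma partial_sums_tail S f m n : is_partial_sums S f ->
  m ∈ omega -> n ∈ omega -> f⟦m⟧ <= f⟦n⟧ + 3%:R / 2%:R * pw⟦n⟧.
Proof.
move=> hS hm hn; have [_ [f0 fS]] := hS; have [_ [pw0 pwS]] := hpw.
have dec : forall k l, k ∈ omega -> l ∈ omega -> k ⊆ l ->
    f⟦l⟧ + 3%:R / 2%:R * pw⟦l⟧ <= f⟦k⟧ + 3%:R / 2%:R * pw⟦k⟧.
  apply: (@omega_chain M (fun k l =>
    f⟦l⟧ + 3%:R / 2%:R * pw⟦l⟧ <= f⟦k⟧ + 3%:R / 2%:R * pw⟦k⟧)).
  - by definability.
  - by move=> k _; lra.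
  - move=> k l hk hl; rewrite pwS //.
    by have := powers_gt0 hl; case: (fS l hl) => -[_ ->]; lra.
have pn := powers_gt0 hn; have pm := powers_gt0 hm.
have [mn|nm] : m ⊆ n \/ n ⊆ m.
  rewrite !nat_subset // !mem_succ.
  by have := nat_total hm hn; intuition.
  by have := partial_sums_increasing hS hm hn mn; lra.
by have := dec n m hn hm nm; lra.
Qed.

Lemma cantor_value_exists S : exists x, x ∈ Rset R /\ is_cantor_value S x.
Proof.
have [f hS] := partial_sums_exist S.
have [|l [h1 h2]] := bounded_sup K (proj1 hS).
  by eexists => n hn; apply: (partial_sums_tail hS hn omega_zero).
exists #l; split; first exact: coord_in.
exists f; split=> //; rewrite coordK; split=> // y hy h; exact: h2.
Qed.

Section Values.
Variables (S x : M).
Hypothesis cx : is_cantor_value S x.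

Lemma cantor_value_le f n : is_partial_sums S f -> n ∈ omega ->
  value K x <= f⟦n⟧ + 3%:R / 2%:R * pw⟦n⟧.
Proof.
move=> hS hn; have [g [hg [_ g2]]] := cx; rewrite -[X in _ <= X]coordK.
apply: g2 => [|m hm]; first exact: coord_in.
have -> : g⟦m⟧ = f⟦m⟧ by apply: partial_sums_agree hg hS hm _.
by rewrite coordK; apply: (partial_sums_tail hS hm hn).
Qed.

Lemma cantor_value_ge f n : is_partial_sums S f -> n ∈ omega -> f⟦n⟧ <= value K x.
Proof.
move=> hS hn; have [g [hg [g1 _]]] := cx.
have <- : g⟦n⟧ = f⟦n⟧ by apply: partial_sums_agree hg hS hn _.
exact: g1.
Qed.

Lemma cantor_value_ge_digit n : n ∈ omega -> n ∈ S -> pw⟦n⟧ <= value K x.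
Proof.
move=> hn nS; have [f hS] := partial_sums_exist S.
have h1 := cantor_value_ge hS (omega_succ hn).
have h2 := partial_sums_increasing hS omega_zero hn (_ : zero ⊆ n).
have [_ [f0 fS]] := hS; case: (fS n hn) => -[] // _ e.
by have := h2 (fun z hz => match mem_zero hz with end); move: h1; rewrite e f0; lra.
Qed.

Lemma cantor_value_small n : n ∈ omega -> (forall k, k ∈ S -> k ∉ n) ->
  0 <= value K x <= 3%:R / 2%:R * pw⟦n⟧.
Proof.
move=> hn nS; have [f hS] := partial_sums_exist S.
have e : f⟦n⟧ = 0.
  have [g hg] := partial_sums_exist zero.
  have -> : f⟦n⟧ = g⟦n⟧.
    by apply: partial_sums_agree hS hg hn _ => k kn; split=> [/nS|/mem_zero].
  have [_ [g0 gS]] := hg; move: n hn {nS}; apply: omega_ind; [by definability|by []|].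
  by move=> n hn IH; case: (gS n hn) => -[]; [move=> /mem_zero|move=> _ ->].
have h1 := cantor_value_le hS hn; have h2 := cantor_value_ge hS hn.
by rewrite e in h1 h2; apply/andP; split; lra.
Qed.
End Values.

(** A digit outweighs all later digits together, so the first difference decides
    the order. *)
Lemma cantor_value_lt S T x y n : x ∈ Rset R -> y ∈ Rset R ->
  is_cantor_value S x -> is_cantor_value T y -> n ∈ omega ->
  (forall k, k ∈ n -> k ∈ S <-> k ∈ T) -> n ∈ S -> n ∉ T ->
  value K y < value K x.
Proof.
move=> hx hy cx cy hn ag nS nT; have [_ [_ pwS]] := hpw.
have [f hf] := partial_sums_exist S; have [g hg] := partial_sums_exist T.
have h1 := cantor_value_ge cx hf (omega_succ hn).
have h2 := cantor_value_le cy hg (omega_succ hn).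
have e := partial_sums_agree hf hg hn ag; have p0 := powers_gt0 hn.
have [_ [_ fS]] := hf; have [_ [_ gS]] := hg.
case: (fS n hn) => -[] // _ ef; case: (gS n hn) => -[] // _ eg.
by move: h1 h2; rewrite ef eg e pwS //; lra.
Qed.

Lemma cantor_value_inj S T x : S ⊆ omega -> T ⊆ omega -> x ∈ Rset R ->
  is_cantor_value S x -> is_cantor_value T x -> S = T.
Proof.
move=> sS sT hx cS cT; apply: contrapT => ne.
have [n [hn dn]] : exists n, n ∈ omega /\ ~ (n ∈ S <-> n ∈ T).
  apply: contrapT => no; apply: ne; apply: ext => n.
  have [hn|hn] := pselect (n ∈ omega).
    by apply: contrapT => ?; apply: no; exists n.
  by split=> [/sS|/sT].
have [|||m [hm [dm lm]]] := @omega_least M (fun n => ~ (n ∈ S <-> n ∈ T)) n.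
- by definability.
- by [].
- by [].
have ag k : k ∈ m -> k ∈ S <-> k ∈ T by move=> /lm ?; apply: contrapT.
have [mS|mS] := pselect (m ∈ S).
  have mT : m ∉ T by move=> mT; apply: dm.
  by have := cantor_value_lt hx hx cS cT hm ag mS mT; lra.
have mT : m ∈ T by apply: contrapT => mT; apply: dm; split=> //.
have ag' k : k ∈ m -> k ∈ T <-> k ∈ S by move/ag; tauto.
by have := cantor_value_lt hx hx cT cS hm ag' mT mS; lra.
Qed.

(** Multiples of a small power, shifted by naturals to reach negative reals. *)
Lemma dense_sequence : exists d, is_function d omega (Rset R) /\
  forall u v, u < v -> exists k, k ∈ omega /\ u < d⟦k⟧ /\ d⟦k⟧ < v.
Proof.
have [nu hnu] := naturals K.
have [h1 [h2 [hh1 [hh2 [_ onto]]]]] := pairing_onto hnu.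
pose t k := nu⟦app h1 k⟧ * pw⟦app h2 (app h2 k)⟧ - nu⟦app h1 (app h2 k)⟧.
have [|||d [hd dP]] := @function_of_relation M omega (Rset R) (fun k y => y = #(t k)).
- by definability.
- by move=> k _; exists #(t k); split=> //; apply: coord_in.
- by move=> k y y' _ _ _ -> ->.
have dE k : k ∈ omega -> d⟦k⟧ = t k by move=> hk; rewrite /term dP // coordK.
exists d; split=> // u v uv.
have [b [hb ub]] := naturals_archimedean hnu (- u).
have [|n [hn pn]] := @powers_small (v - u); first by lra.
have p0 := powers_gt0 hn; have [_ [nu0 nuS]] := hnu.
have [a [ha [pa la]]] : exists a, a ∈ omega /\ u + nu⟦b⟧ < nu⟦a⟧ * pw⟦n⟧ /\
    forall k, k ∈ a -> ~ (u + nu⟦b⟧ < nu⟦k⟧ * pw⟦n⟧).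
  have [a [ha pa]] := naturals_archimedean hnu ((u + nu⟦b⟧) / pw⟦n⟧).
  apply: (@omega_least M (fun a => u + nu⟦b⟧ < nu⟦a⟧ * pw⟦n⟧) a) => //; first by definability.
  by rewrite -Num.Theory.ltr_pdivrMr.
have [k2 [hk2 [e1 e2]]] := onto b n hb hn.
have [k [hk [e3 e4]]] := onto a k2 ha hk2.
exists k; split=> //; rewrite dE // /t e3 e4 e1 e2; split; first by lra.
have [e|[a' [ha' e]]] := nat_case ha; first by move: pa; rewrite e nu0; lra.
have a'a : a' ∈ a by rewrite e mem_succ; right.
have := la a' a'a => /negP; rewrite -Order.TotalTheory.leNgt e nuS //.
by rewrite GRing.mulrDl GRing.mul1r; lra.
Qed.

End Powers.
End RealFacts.

Ltac definability_cantor :=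
  lazymatch goal with
  | |- definable (fun _ => is_cantor_value _ _ _ _) =>
      refine (definable_cantor_value _ _ _ _)
  end.
Ltac definability_hook ::=
  first [definability_cantor | definability_reals | definability_functions
        | definability_pairs | definability_sets].

(** * Metrizable spaces and spaces of reals *)

Section MetricSpaces.
Variable M : zf_model.
Variable R : field_data M.
Variable K : real_coordinates R.
Implicit Types a b f k m n p x y z : M.
Local Notation F := (real_field K).
Local Notation "# u" := (coord K u) (at level 8, format "# u").
Local Notation "f ⟦ n ⟧" := (term K f n)
  (at level 2, n at level 200, left associativity, format "f ⟦ n ⟧").
Implicit Types u v w : F.
Local Open Scope ring_scope.

Lemma ltR_value x y : x ∈ Rset R -> y ∈ Rset R ->
  ltR R x y <-> value K x < value K y.
Proof.
move=> hx hy; rewrite /ltR (leR_value K hx hy) Order.POrderTheory.lt_neqAle.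
split=> [[h ne]|/andP[/eqP ne h]]; last by split=> // e; apply: ne; rewrite e.
by rewrite h andbT; apply/eqP => e; apply: ne; rewrite -(valueK K hx) e valueK.
Qed.

Lemma metrizable_hausdorff (X : space M) : metrizable R X -> hausdorff X.
Proof.
move=> [d [hd opE]]; have hf := proj1 (is_function2E _ _ _ _) (metric_function hd).
pose D x y := d⟦opair x y⟧.
have dom x y : x ∈ points X -> y ∈ points X -> rel2 d x y #(D x y).
  move=> hx hy; rewrite rel2E (rel_function hf) mem_opair_prod /D /term.
  by rewrite valueK //; apply: (app_cod hf); rewrite mem_opair_prod.
have sym x y : x ∈ points X -> y ∈ points X -> D x y = D y x.
  move=> hx hy; have := metric_sym hd (dom x y hx hy); rewrite rel2E (rel_function hf).
  by move=> [_ e]; rewrite [RHS]/D /term e coordK.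
have tri x y z : x ∈ points X -> y ∈ points X -> z ∈ points X ->
    D x z <= D x y + D y z.
  move=> hx hy hz; rewrite -(coord_le K).
  apply: (metric_triangle hd (dom x y hx hy) (dom y z hy hz) (dom x z hx hz)).
  exact/coord_add.
have pos x y : x ∈ points X -> y ∈ points X -> x <> y -> 0 < D x y.
  move=> hx hy ne; have := metric_nonneg hd (dom x y hx hy).
  rewrite (coord_zero K) coord_le Order.POrderTheory.le_eqVlt => /orP[/eqP e|//].
  by case: ne; apply/(metric_zero hd x y hx hy); rewrite (coord_zero K) e; apply: dom.
pose ball x u := sep (points X) (fun y => D x y < u).
have ballE x u y : y ∈ ball x u <-> y ∈ points X /\ D x y < u.
  by rewrite /ball /D; rewrite_sep.
have self x : x ∈ points X -> D x x = 0.
  move=> hx; have := proj2 (metric_zero hd x x hx hx) erefl.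
  rewrite (coord_zero K) rel2E (rel_function hf) => -[_ e].
  by rewrite /D /term e coordK.
have ball_open x u : x ∈ points X -> ball x u ∈ opens X.
  move=> hx; rewrite opE; split=> [y|y]; rewrite ballE; first by case.
  move=> [hy yu]; exists #(u - D x y); split; first exact: coord_in.
  split=> [|z s hs].
    rewrite (coord_zero K) ltR_value ?coordK; try exact: coord_in.
    lra.
  have [/mem_opair_prod[_ hz] hsR] := rel_dom hf (proj1 (rel2E _ _ _ _) hs).
  have es : s = #(D y z).
    by move: hs; rewrite rel2E (rel_function hf) /D /term => -[_ <-]; rewrite valueK //;
      apply: (app_cod hf); rewrite mem_opair_prod.
  rewrite es ltR_value ?coordK; try exact: coord_in.
  by move=> h; rewrite ballE; split=> //; have := tri x y z hx hy hz; lra.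
move=> x y hx hy ne; have p := pos x y hx hy ne.
exists (ball x (D x y / 2%:R)), (ball y (D x y / 2%:R)).
split; first exact: ball_open.
split; first exact: ball_open.
rewrite !ballE (self x) // (self y) //; split; first by split=> //; lra.
split; first by split=> //; lra.
move=> z; rewrite !ballE => -[hz h1] [_ h2].
have := tri x z y hx hz hy; rewrite (sym z y) //; lra.
Qed.

(** The sets of codes of the points of [a] in the basic neighbourhoods of a limit
    point form a decreasing sequence without common element, hence an infinite
    countable family. *)
Lemma choice_frechet_urysohn (X : space M) e : CAC_R R ->
  is_topology X -> hausdorff X -> enumerates_base X e -> frechet_urysohn X.
Proof.
move=> cac hX haus he a x aX clx; exists omega.
suff [s hs] : exists s, is_function s omega a /\ converges_to X omega s x.
  by exists s; rewrite is_omegaE.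
have [xa|xa] := pselect (x ∈ a); first exact: constant_sequence.
have [hx cl] := proj1 (in_closureE hX x aX) clx.
have [pw hpw] : exists pw, is_powers K pw := powers K.
pose codes y := sep omega (fun k => y ∈ app e k).
have codesE y k : k ∈ codes y <-> k ∈ omega /\ y ∈ app e k by rewrite /codes; rewrite_sep.
have codes_inj y z : y ∈ points X -> z ∈ points X -> codes y = codes z -> y = z.
  move=> hy hz E; apply: contrapT => ne.
  have [u [v [hu [hv [yu [zv d]]]]]] := haus y z hy hz ne.
  have [k [hk [yk ku]]] := proj2 he u y hu yu.
  have /codesE[_ zk] : k ∈ codes z by rewrite -E codesE.
  by apply: (d z) => //; apply: ku.
pose code y r := is_cantor_value K pw (codes y) r.
have code_inj y z r : y ∈ points X -> z ∈ points X -> r ∈ Rset R ->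
    code y r -> code z r -> y = z.
  move=> hy hz hr h1 h2; apply: codes_inj => //.
  by apply: (cantor_value_inj hpw _ _ hr h1 h2) => k /codesE[].
pose fam n := sep (Rset R) (fun r => exists y, y ∈ a /\ y ∈ nbhd X e x n /\ code y r).
have famE n r : r ∈ fam n <->
    r ∈ Rset R /\ exists y, y ∈ a /\ y ∈ nbhd X e x n /\ code y r.
  by rewrite /fam /code /codes; rewrite_sep.
have fam_ne n : n ∈ omega -> nonempty (fam n).
  move=> hn; have [y [yN ya]] := cl _ (nbhd_open hX he x hn) (mem_nbhd_self e n hx).
  have [r [hr cr]] := cantor_value_exists hpw (codes y).
  by exists r; rewrite famE; split=> //; exists y.
have fam_anti m n : m ⊆ n -> fam n ⊆ fam m.
  move=> mn r; rewrite !famE => -[hr [y [ya [yN cr]]]]; split=> //.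
  by exists y; split=> //; split=> //; apply: nbhd_antitone mn _ yN.
pose Fm := sep (pow (Rset R)) (fun A => exists n, n ∈ omega /\ A = fam n).
have FmE A : A ∈ Fm <-> exists n, n ∈ omega /\ A = fam n.
  rewrite /Fm; rewrite_sep.
  rewrite mem_pow; split=> [[]//|[n [hn ->]]]; split; last by exists n.
  by move=> r /famE[].
have infinite_Fm : infinite Fm.
  move=> fin; have : Fm ⊆ Fm -> exists n, n ∈ omega /\ forall A, A ∈ Fm -> fam n ⊆ A.
    have : finite Fm := fin; move: {1 2 4}Fm; apply: finite_ind.
    - by definability.
    - by move=> _; exists zero; split; [exact: omega_zero|move=> A /mem_zero].
    move=> t A IH tF; have [|n [hn h]] := IH.
      by move=> B Bt; apply: tF; rewrite mem_insert; left.
    have /FmE[m [hm ->]] : A ∈ Fm by apply: tF; rewrite mem_insert; right.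
    have [mn|nm] : m ⊆ n \/ n ⊆ m.
      by rewrite !nat_subset // !mem_succ; have := nat_total hm hn; intuition.
    - by exists n; split=> // B; rewrite mem_insert => -[/h|->] //; apply: fam_anti.
    - exists m; split=> // B; rewrite mem_insert => -[/h nB r|->] // rm.
      by apply/nB/(fam_anti n m).
  move=> /(_ (fun _ h => h))[n [hn h]].
  have [r rn] := fam_ne n hn; have /famE[hr [y [ya [_ cy]]]] := rn.
  have hy := aX y ya; have [|u [v [hu [hv [xu [yv d]]]]]] := haus x y hx hy.
    by move=> E; apply: xa; rewrite E.
  have [m [hm mu]] := nbhd_basis he hu xu.
  have /h/(_ r rn)/famE[_ [z [za [zN cz]]]] : fam m ∈ Fm by rewrite FmE; exists m.
  have E := code_inj y z r hy (aX z za) hr cy cz; subst z.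
  by apply: (d y) => //; apply: (mu m).
have den : denumerable Fm.
  split=> //; apply: (@countable_of_relation M Fm (fun A n => A = fam n)).
  - by definability.
  - by move=> A /FmE.
  - by move=> A B n _ _ _ -> ->.
have [A /FmE[n [hn ->]]|f [hf ch]] := cac Fm den.
  by split; [move=> r /famE[]|apply: fam_ne].
have [|||s [hs sQ]] := @function_of_relation M omega a (fun n y =>
  y ∈ nbhd X e x n /\ code y (app f (fam n))).
- by definability.
- move=> n hn; have nF : fam n ∈ Fm by rewrite FmE; exists n.
  by have /famE[_ [y [ya h]]] := ch _ _ nF (app_rel hf nF); exists y.
- move=> n y z hn ya za [_ cy] [_ cz]; have nF : fam n ∈ Fm by rewrite FmE; exists n.
  exact: (code_inj y z _ (aX y ya) (aX z za) (app_cod hf nF) cy cz).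
exists s; split=> //; apply: (converges_of_nbhd he) => n y hn.
by rewrite (rel_function hs) => -[_ <-]; case: (sQ n hn).
Qed.

Section RealSpace.
Variable A : M.
Hypothesis sA : A ⊆ Rset R.

(** [|x - y| < r], in a form that is visibly definable. *)
Definition near x r y : Prop :=
  value K x - value K r < value K y /\ value K y < value K x + value K r.

Definition real_space : space M := @Space M A (sep (pow A) (fun o =>
  forall x, x ∈ o -> exists r, 0 < value K r /\ forall y, y ∈ A -> near x r y -> y ∈ o)).

Lemma mem_real_opens o : o ∈ opens real_space <-> o ⊆ A /\
  forall x, x ∈ o -> exists r : F, 0 < r /\ forall y, y ∈ A ->
    value K x - r < value K y < value K x + r -> y ∈ o.
Proof.
rewrite /real_space /= mem_sep; last by definability.
rewrite mem_pow /near; split=> -[oA h]; split=> // x /h[r [r0 hr]].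
  by exists (value K r); split=> // y hy /andP[h1 h2]; apply: hr.
by exists #r; rewrite coordK; split=> // y hy [h1 h2]; apply: hr => //; rewrite h1.
Qed.

Lemma real_space_topology : is_topology real_space.
Proof.
split=> [o|o||o o' i|s o hs].
- by rewrite mem_real_opens => -[].
- by rewrite mem_real_opens is_emptyE => ->; split=> x /mem_zero.
- by rewrite mem_real_opens; split=> // x _; exists 1; split=> //; lra.
- rewrite is_interE !mem_real_opens => -[oA ho] [_ ho'] ->.
  split=> [x|x]; rewrite mem_cap => -[xo xo']; first exact: oA.
  have [r [r0 hr]] := ho x xo; have [r' [r0' hr']] := ho' x xo'.
  have [le|lt] := Order.TotalTheory.leP r r'.
    exists r; split=> // y hy h; rewrite mem_cap; split; first exact: hr.
    by apply: hr' => //; lra.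
  exists r'; split=> // y hy h; rewrite mem_cap; split; last exact: hr'.
  by apply: hr => //; lra.
- rewrite is_unionE mem_real_opens => ->; split=> x; rewrite mem_union => -[o' [o's xo]].
    by have /mem_real_opens[] := hs _ o's => h _; apply: h.
  have /mem_real_opens[_ /(_ x xo)[r [r0 hr]]] := hs _ o's.
  by exists r; split=> // y hy h; rewrite mem_union; exists o'; split=> //; apply: hr.
Qed.

(** The basic sets are the intervals whose ends are terms of a dense sequence,
    indexed through a pairing of the naturals. *)
Lemma real_space_enumerates : exists e, enumerates_base real_space e.
Proof.
have [pw hpw] : exists pw, is_powers K pw := powers K.
have [d [hd dense]] := dense_sequence hpw.
have [nu hnu] := naturals K; have [h1 [h2 [hh1 [hh2 [_ onto]]]]] := pairing_onto hnu.
pose I k := sep A (fun y => d⟦app h1 k⟧ < value K y /\ value K y < d⟦app h2 k⟧).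
have IE k y : y ∈ I k <-> y ∈ A /\ d⟦app h1 k⟧ < value K y < d⟦app h2 k⟧.
  by rewrite /I; rewrite_sep; split=> -[hy]; [move=> [-> ->]|move=> /andP].
have [|||e [he eQ]] := @function_of_relation M omega (opens real_space) (fun k o => o = I k).
- by definability.
- move=> k hk; exists (I k); split=> //; rewrite mem_real_opens; split=> x; rewrite IE; first by case.
  move=> [hx /andP[l1 l2]].
  have [le|lt] := Order.TotalTheory.leP (value K x - d⟦app h1 k⟧) (d⟦app h2 k⟧ - value K x).
    exists (value K x - d⟦app h1 k⟧); split; first by lra.
    by move=> y hy h; rewrite IE; split=> //; lra.
  exists (d⟦app h2 k⟧ - value K x); split; first by lra.
  by move=> y hy h; rewrite IE; split=> //; lra.
- by move=> k o o' _ _ _ -> ->.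
exists e; split=> // o x; rewrite mem_real_opens => -[oA ho] xo.
have [r [r0 hr]] := ho x xo.
have [|i [hi [i1 i2]]] := dense (value K x - r) (value K x); first by lra.
have [|j [hj [j1 j2]]] := dense (value K x) (value K x + r); first by lra.
have [k [hk [e1 e2]]] := onto i j hi hj.
exists k; split=> //; rewrite eQ // IE e1 e2; split.
  by split; [exact: oA|rewrite i2].
by move=> y; rewrite IE e1 e2 => -[hy h]; apply: hr => //; lra.
Qed.

Lemma real_space_metrizable : metrizable R real_space.
Proof.
pose Q z s := exists x y, z = opair x y /\
  ((value K x <= value K y /\ s = #(value K y - value K x)) \/
   (value K y <= value K x /\ s = #(value K x - value K y))).
have QE x y s : Q (opair x y) s <-> s = #(`|value K x - value K y|).
  split=> [[x' [y' [/opair_inj[<- <-] [[h ->]|[h ->]]]]]|->].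
  - by rewrite Num.Theory.ler0_norm; [congr #_; lra|lra].
  - by rewrite Num.Theory.ger0_norm //; lra.
  exists x, y; split=> //; have [h|h] := Order.TotalTheory.leP (value K x) (value K y).
    by left; split=> //; rewrite Num.Theory.ler0_norm; [congr #_; lra|lra].
  by right; split; [lra|rewrite Num.Theory.ger0_norm //; lra].
have [|||d [hd dQ]] := @function_of_relation M (prod A A) (Rset R) Q.
- by definability.
- move=> z; rewrite mem_prod => -[x [y [_ [_ ->]]]].
  by eexists; rewrite QE; split; last reflexivity; apply: coord_in.
- by move=> z s s'; rewrite mem_prod => -[x [y [_ [_ ->]]]] _ _; rewrite !QE => -> ->.
have dE x y s : rel2 d x y s <-> (x ∈ A /\ y ∈ A) /\ s = #(`|value K x - value K y|).
  rewrite rel2E (rel_function hd) mem_opair_prod.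
  split=> -[hxy]; first by move=> <-; split=> //; apply/QE/dQ; rewrite mem_opair_prod.
  by move=> ->; split=> //; apply/QE/dQ; rewrite mem_opair_prod.
exists d; split.
  split=> [|x y r|x y hx hy|x y r|x y z r1 r2 r3 r4].
  - by rewrite is_function2E.
  - by rewrite dE => -[_ ->]; rewrite (coord_zero K) coord_le.
  - rewrite dE (coord_zero K); split=> [[_ /(coord_inj K)/esym/eqP]|->].
      rewrite Num.Theory.normr_eq0 GRing.subr_eq0 => /eqP e.
      by rewrite -(valueK K (sA hx)) e valueK //; apply: sA.
    by split=> //; congr #_; rewrite GRing.subrr Num.Theory.normr0.
  - by rewrite !dE => -[[hx hy] ->]; rewrite Num.Theory.distrC.
  - rewrite !dE => -[_ ->] [_ ->] [_ ->] /coord_add ->; rewrite coord_le.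
    exact: Num.Theory.ler_distD.
move=> o; rewrite mem_real_opens; split=> -[oA ho]; split=> // x xo.
  have [r [r0 hr]] := ho x xo; exists #r; split; first exact: coord_in.
  split=> [|y s]; first by rewrite (coord_zero K) ltR_value ?coordK //; exact: coord_in.
  rewrite dE => -[[_ hy] ->]; rewrite ltR_value ?coordK; try exact: coord_in.
  by rewrite Num.Theory.ltr_norml => /andP[h1 h2]; apply: hr => //; lra.
have [r [hr [r0 h]]] := ho x xo; exists (value K r); split.
  by move: r0; rewrite (coord_zero K) ltR_value ?coordK //; exact: coord_in.
move=> y hy hyr; apply: (h y #(`|value K x - value K y|)).
  by rewrite dE; split=> //; split=> //; apply: oA.
rewrite ltR_value ?coordK //; last exact: coord_in.
by rewrite Num.Theory.ltr_norml; lra.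
Qed.

End RealSpace.
End MetricSpaces.

(** * Choice from convergence *)

Section Choice.
Variable M : zf_model.
Variable R : field_data M.
Variable K : real_coordinates R.
Implicit Types a b f g i j k m n p r x y z : M.
Local Notation "# u" := (coord K u) (at level 8, format "# u").
Local Notation "f ⟦ n ⟧" := (term K f n)
  (at level 2, n at level 200, left associativity, format "f ⟦ n ⟧").
Local Open Scope ring_scope.

(** The points are codes of choice functions for initial segments of the family,
    together with [0]; a sequence of codes can converge to [0] only if the lengths
    of the segments tend to infinity.  Finite choice makes [0] a limit point, and
    a sequence of codes that converges to [0] provides choices for all members
    of the family. *)
Lemma k_spaces_choice :
  (forall A, A ⊆ Rset R -> k_space (real_space K A)) -> CAC_R R.
Proof.
move=> ksp Fm [cF _] hF.
have [idx [hidx idx_inj]] := proj1 (countableE _) cF.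
have [pw hpw] : exists pw, is_powers K pw := powers K.
have [d [hd dense]] := dense_sequence hpw.
have [nu hnu] := naturals K; have [h1 [h2 [hh1 [hh2 [h1le onto]]]]] := pairing_onto hnu.
(* the [i]-th set of the family; all of the line if [i] is not an index *)
pose In i r := r ∈ Rset R /\ forall a, a ∈ Fm -> app idx a = i -> r ∈ a.
have In_ex i : exists r, In i r.
  have [[a [aF ai]]|no] := pselect (exists a, a ∈ Fm /\ app idx a = i).
    have [sa [r ra]] := hF a aF; exists r; split; first exact: sa.
    by move=> b bF bi; rewrite (idx_inj b a) // ai.
  exists #0; split; first exact: coord_in.
  by move=> a aF ai; case: no; exists a.
pose chooses n g := is_function g n (Rset R) /\ forall i, i ∈ n -> In i (app g i).
have chooses_ex n : n ∈ omega -> exists g, chooses n g.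
  move: n; apply: omega_ind; first by definability.
    by exists zero; split; [split=> [p|x]|] => /= [/mem_zero|/mem_zero|i /mem_zero].
  move=> n hn [g [hg gI]]; have [r0 [r0R r0I]] := In_ex n.
  have [|||g' [hg' g'Q]] := @function_of_relation M (succ n) (Rset R)
    (fun i y => i ∈ n /\ y = app g i \/ i = n /\ y = r0).
  - by definability.
  - move=> i; rewrite mem_succ => -[hi|->].
      by exists (app g i); split; [apply: (app_cod hg)|left].
    by exists r0; split=> //; right.
  - by move=> i y y' _ _ _ [[hi ->]|[ei ->]] [[hi' ->]|[ei' ->]] //;
      subst i; have /mem_irrefl : n ∈ n by [].
  exists g'; split=> // i hi; case: (g'Q i hi) => -[h ->]; first exact: gI.
  by rewrite h.
(* [k] is read as a triple [(n, i, m)], where [m] indexes the dense sequence: the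
   code records [n] and the cuts of the reals [g(i)]; the triples with [i = n]
   make the code of a segment of length [n] nonempty in a place fixed by [n] *)
pose code n g := sep omega (fun k => app h1 k = n /\ (app h1 (app h2 k) = n \/
  (app h1 (app h2 k) ∈ n /\
     d⟦app h2 (app h2 k)⟧ < value K (app g (app h1 (app h2 k)))))).
have codeE n g k : k ∈ code n g <-> k ∈ omega /\ app h1 k = n /\
    (app h1 (app h2 k) = n \/ (app h1 (app h2 k) ∈ n /\
     d⟦app h2 (app h2 k)⟧ < value K (app g (app h1 (app h2 k))))).
  by rewrite /code; rewrite_sep.
have onto3 n i m : n ∈ omega -> i ∈ omega -> m ∈ omega -> exists k, k ∈ omega /\
    app h1 k = n /\ app h1 (app h2 k) = i /\ app h2 (app h2 k) = m.
  move=> hn hi hm; have [l [hl [e1 e2]]] := onto i m hi hm.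
  by have [k [hk [e3 e4]]] := onto n l hn hl; exists k; rewrite e3 e4.
have marker n : n ∈ omega -> exists k, k ∈ omega /\ forall g, k ∈ code n g.
  move=> hn; have [k [hk [e1 [e2 e3]]]] := onto3 n n zero hn hn omega_zero.
  by exists k; split=> // g; rewrite codeE; split=> //; split=> //; left.
have code_inj n n' g g' i : n ∈ omega -> n' ∈ omega -> code n g = code n' g' ->
    is_function g n (Rset R) -> is_function g' n' (Rset R) ->
    i ∈ n -> app g i = app g' i.
  move=> hn hn' E hg hg' hi.
  have En : n = n'.
    have [k [hk kg]] := marker n hn; have := kg g; rewrite E codeE => -[_ [<- _]].
    by have := kg g; rewrite codeE => -[_ [->]].
  subst n'; have oi := omega_trans hn hi.
  have half f f' : code n f = code n f' -> ~ value K (app f i) < value K (app f' i).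
    move=> E' lt; have [m [hm [m1 m2]]] := dense _ _ lt.
    have [k [hk [e1 [e2 e3]]]] := onto3 n i m hn oi hm.
    have : k ∈ code n f' by rewrite codeE e1 e2 e3; split=> //; split=> //; right.
    rewrite -E' codeE e1 e2 e3 => -[_ [_ [e|[_ lt2]]]].
      by move: hi; rewrite e => /mem_irrefl.
    by lra.
  rewrite -(valueK K (app_cod hg hi)) -(valueK K (app_cod hg' hi)); congr #_.
  have l1 := half g g' E; have l2 := half g' g (esym E).
  by have [/l1|/l2|] := Order.TotalTheory.ltgtP (value K (app g i)) (value K (app g' i)).
pose point n r := exists g, chooses n g /\ is_cantor_value K pw (code n g) r.
pose B := sep (Rset R) (fun r => exists n, n ∈ omega /\ point n r).
have BE r : r ∈ B <-> r ∈ Rset R /\ exists n, n ∈ omega /\ point n r.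
  by rewrite /B /point /chooses /In /code; rewrite_sep.
have level_bound n : n ∈ omega -> exists m, m ∈ omega /\
    forall r, r ∈ Rset R -> point n r -> pw⟦m⟧ <= value K r.
  move=> hn; have [k [hk kg]] := marker n hn; exists k; split=> // r hr [g [_ cr]].
  exact: (cantor_value_ge_digit hpw cr hk (kg g)).
have initial_bound n : n ∈ omega -> exists m, m ∈ omega /\
    forall k r, k ∈ n -> r ∈ Rset R -> point k r -> pw⟦m⟧ <= value K r.
  move: n; apply: omega_ind; first by definability.
    by exists zero; split=> [|k r /mem_zero]; first exact: omega_zero.
  move=> n hn [m [hm h]]; have [m' [hm' h']] := level_bound n hn.
  have [mm|mm] : m ⊆ m' \/ m' ⊆ m.
    by rewrite !nat_subset // !mem_succ; have := nat_total hm hm'; intuition.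
  - exists m'; split=> // k r; rewrite mem_succ => -[kn|->] hr pr; last exact: h'.
    by have := h k r kn hr pr; have := powers_antitone hpw hm hm' mm; lra.
  - exists m; split=> // k r; rewrite mem_succ => -[kn|->] hr pr; first exact: (h k).
    by have := h' r hr pr; have := powers_antitone hpw hm' hm mm; lra.
pose A := insert #0 B.
have sA : A ⊆ Rset R by move=> r; rewrite mem_insert => -[/BE[]|->] //; apply: coord_in.
have hX := real_space_topology K A.
have haus := metrizable_hausdorff K (real_space_metrizable K sA).
have [e he] := real_space_enumerates K A.
have zB : #0 ∉ B.
  move=> /BE[_ [n [hn pn]]]; have [m [hm h]] := level_bound n hn.
  have := h _ (coord_in K 0) pn; rewrite coordK; have := powers_gt0 hpw hm; lra.
have [|||s [hs cv]] := k_space_sequence hX haus (a := B) (x := #0) he (ksp A sA).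
- by move=> y /=; rewrite mem_insert.
- exact: zB.
- rewrite in_closureE //; last by move=> y yB /=; rewrite mem_insert; left.
  split=> [|o]; first by rewrite /= mem_insert; right.
  move=> /(mem_real_opens K)[_ ho] /ho[u [u0 hu]].
  have [|n [hn pn]] := powers_small hpw (u := u / 2%:R); first by lra.
  (* [h1 k] is at most [k], so the code of a segment of length [n] starts at [n] *)
  have [g hg] := chooses_ex n hn; have [r [hr cr]] := cantor_value_exists hpw (code n g).
  have rB : r ∈ B by rewrite BE; split=> //; exists n; split=> //; exists g.
  exists r; split=> //; apply: hu; first by rewrite mem_insert; left.
  have := cantor_value_small hpw cr hn; rewrite coordK => small.
  have /small/andP[s1 s2] : forall k, k ∈ code n g -> k ∉ n.
    move=> k; rewrite codeE => -[hk' [e1 _]] kn.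
    have := h1le k hk'; rewrite e1 mem_succ => -[nk|nk].
      by have /mem_irrefl := nat_trans hn kn nk.
    by move: kn; rewrite nk => /mem_irrefl.
  by lra.
have sB j : j ∈ omega -> app s j ∈ Rset R /\ exists n, n ∈ omega /\ point n (app s j).
  by move=> hj; rewrite -BE; apply: (app_cod hs).
have long i : i ∈ omega -> exists j, j ∈ omega /\
    exists n, n ∈ omega /\ i ∈ n /\ point n (app s j).
  move=> hi; have [m [hm hb]] := initial_bound _ (omega_succ hi).
  have p0 := powers_gt0 hpw hm.
  pose o := sep A (fun y => value K y < pw⟦m⟧).
  have oE y : y ∈ o <-> y ∈ A /\ value K y < pw⟦m⟧ by rewrite /o; rewrite_sep.
  have ho : o ∈ opens (real_space K A).
    rewrite mem_real_opens; split=> x; rewrite oE => -[xA lt] //.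
    by exists (pw⟦m⟧ - value K x); split=> [|y yA h]; rewrite ?oE; [lra|split=> //; lra].
  have [|j [hj hN]] := cv o ho; first by rewrite oE coordK mem_insert; split=> //; right.
  exists j; split=> //; have [hsj [n [hn pn]]] := sB j hj; exists n; split=> //.
  split=> //; apply: contrapT => ni.
  have /oE[_ lt] : app s j ∈ o by apply: (hN j) => //; apply: (app_rel hs).
  have := hb n _ _ hsj pn; have ns : n ∈ succ i by rewrite -nat_not_mem.
  by move=> /(_ ns); lra.
pose Q a r := exists j, j ∈ omega /\
  (forall l, l ∈ j -> ~ exists n, n ∈ omega /\ app idx a ∈ n /\ point n (app s l)) /\
  exists n g, n ∈ omega /\ app idx a ∈ n /\ chooses n g /\
    is_cantor_value K pw (code n g) (app s j) /\ r = app g (app idx a).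
have [|||f [hf fQ]] := @function_of_relation M Fm (Rset R) Q.
- by definability.
- move=> a aF; have hi := app_cod hidx aF; have [j0 [hj0 pj0]] := long _ hi.
  have [|||j [hj [[n [hn [ni [g [hg cg]]]]] lj]]] := @omega_least M (fun j =>
    exists n, n ∈ omega /\ app idx a ∈ n /\ point n (app s j)) j0; [|exact: hj0|exact: pj0|].
    by definability.
  exists (app g (app idx a)); split; first exact: (app_cod (proj1 hg)).
  by exists j; split=> //; split=> //; exists n, g.
- move=> a r r' aF _ _ [j [hj [lj [n [g [hn [ni [hg [cg ->]]]]]]]]].
  move=> [j' [hj' [lj' [n' [g' [hn' [ni' [hg' [cg' ->]]]]]]]]].
  have E : j = j'.
    have [/lj' []|[//|/lj []]] := nat_total hj hj'.
      by exists n; split=> //; split=> //; exists g.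
    by exists n'; split=> //; split=> //; exists g'.
  subst j'; have [hsj _] := sB j hj.
  apply: (code_inj n n') => //; [|exact: (proj1 hg)|exact: (proj1 hg')].
  by apply: (cantor_value_inj hpw _ _ hsj cg cg') => k /codeE[].
exists f; split=> // a r aF; rewrite (rel_function hf) => -[_ <-].
have [j [_ [_ [n [g [_ [ni [[_ gI] [_ ->]]]]]]]]] := fQ a aF.
by have [_] := gI _ ni; apply.
Qed.

End Choice.

(** * The theorem *)

Theorem theorem6p5 (M : set_structure) (hM : ZF M)
    (R : field_data M) (hR : is_real_line R) :
  (forall X : space M, second_countable_metrizable R X ->
     (every_subspace_k_space X <-> frechet_urysohn X) /\
     (every_subspace_k_space X -> uncountable_subsets_contain_infinite_closed X))
  /\
  ((CAC_R R <->
    (forall X : space M, second_countable_metrizable R X ->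
       every_subspace_k_space X)) /\
   ((forall X : space M, second_countable_metrizable R X ->
       every_subspace_k_space X) <->
    (forall X : space M, second_countable_metrizable R X -> k_space X)))
  /\
  ((forall X : space M, second_countable_metrizable R X -> k_space X) ->
   forall X : space M, second_countable_metrizable R X ->
     uncountable_subsets_contain_infinite_closed X).
Proof.
pose N := ZfModel hM.
have [K _] := @real_coordinates_exist N R hR.
have local (X : space M) : second_countable_metrizable R X ->
    (every_subspace_k_space X <-> frechet_urysohn X) /\
    (every_subspace_k_space X -> uncountable_subsets_contain_infinite_closed X).
  move=> [hX [sc met]]; have haus := @metrizable_hausdorff N R K X met.
  have [e he] := proj1 (@second_countable_enumerates N X hX) sc.
  have fu : every_subspace_k_space X <-> frechet_urysohn X.
    split; first exact: (@subspaces_k_frechet_urysohn N X hX e he).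
    exact: (@frechet_urysohn_subspaces_k N X hX haus).
  split=> // /fu; exact: (@frechet_urysohn_infinite_closed N X hX haus e he).
have cac_all : CAC_R R -> forall X : space M, second_countable_metrizable R X ->
    every_subspace_k_space X.
  move=> cac X scm; apply/(proj1 (local X scm)); move: scm => [hX [sc met]].
  have [e he] := proj1 (@second_countable_enumerates N X hX) sc.
  exact: (@choice_frechet_urysohn N R K X e cac hX (@metrizable_hausdorff N R K X met) he).
have all_k : (forall X : space M, second_countable_metrizable R X ->
    every_subspace_k_space X) ->
    forall X : space M, second_countable_metrizable R X -> k_space X.
  move=> h X scm; apply: (h X scm); split=> // v.
  have [hX _] := scm; split=> [hv|[u [hu]]]; [exists v; split=> // z|move=> hi].
    by split=> [zv|[]//]; split=> //; apply: (open_subset hX _ hv).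
  by apply: (open_inter hX hu (open_points hX) hi).
have k_cac : (forall X : space M, second_countable_metrizable R X -> k_space X) ->
    CAC_R R.
  move=> h; apply: (@k_spaces_choice N R K) => A sA; apply: h.
  have hX := @real_space_topology N R K A; split=> //; split.
    exact: (proj2 (@second_countable_enumerates N _ hX) (@real_space_enumerates N R K A)).
  exact: (@real_space_metrizable N R K A sA).
split; first exact: local.
split.
  split; first by split=> // h; apply/k_cac/all_k.
  by split=> // h; apply/cac_all/k_cac.
by move=> h X scm; apply: (proj2 (local X scm)); apply: (cac_all (k_cac h)).
Qed.
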